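(* Consider the controlled system $x_{n+1}=f(x_n)+Bu_n+w_n$, $n\ge0$, controlled over a Class A type noisy channel with feedback, with finite input alphabet $\mathcal{M}$, finite output alphabet $\mathcal{M}'$ and feedback capacity $C$. Suppose that $h(x_0)<\infty$, that $f:\mathbb{R}^N\to\mathbb{R}^N$ is invertible, and that $$M:=\sup_{x\in\mathbb{R}^N}\log_2|J(f(x))|<\infty,\qquad L:=\inf_{x\in\mathbb{R}^N}\log_2|J(f(x))|>-\infty.$$ If under some causal encoding and controller policy the state process $\{x_t\}$ is asymptotically mean stationary (AMS), then the channel capacity must satisfy $C\ge L$.
   Context: System: $x_n\in\mathbb{R}^N$ is the state, $u_n\in\mathbb{R}^s$ the control, $B$ a real $N\times s$ matrix, and $\{w_n\}$ an i.i.d. sequence of $\mathbb{R}^N$-valued noise variables with law $\nu$, independent of $x_0$. $f$ is measurable and continuously differentiable; $J(f(x))$ is its Jacobian matrix at $x$ and $|J(\cdot)|$ denotes the absolute value of the determinant. All random variables live on a common probability space. Causal (admissible) policies: the channel input at time $t$ is $q_t=\gamma^e_t(x_{[0,t]},q'_{[0,t-1]})\in\mathcal{M}$ and the control is $u_t=\gamma_t(q'_{[0,t]})$, for (measurable) functions $\gamma^e_t,\gamma_t$, where $q'_t\in\mathcal{M}'$ is the channel output and $y_{[0,t]}=\{y_s,0\le s\le t\}$. The channel generates $q'_t$ according to a conditional probability $P(q'_t\mid q_t,q_{[0,t-1]},q'_{[0,t-1]})$ on $\mathcal{M}'$. Directed information: $I(q_{[0,T-1]}\to q'_{[0,T-1]})=\sum_{t=1}^{T-1}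 I(q_{[0,t]};q'_t\mid q'_{[0,t-1]})+I(q_0;q'_0)$. Class A channel: (1) for all $t\ge0$, almost surely and for all sets $A\subset\mathcal{M}'$, $P(q'_t\in A\mid q_t,q_{[0,t-1]},q'_{[0,t-1]},x_0,w_s,s\ge 0)=P(q'_t\in A\mid q_t,q_{[0,t-1]},q'_{[0,t-1]})$; and (2) the capacity with feedback is $C=\lim_{T\to\infty}\max_{\{P(q_t\mid q_{[0,t-1]},q'_{[0,t-1]}),\,0\le t\le T-1\}}\frac1T I(q_{[0,T-1]}\to q'_{[0,T-1]})$. AMS: let $\Sigma$ be the space of one-sided sequences in $\mathbb{R}^N$ with its product (cylinder) $\sigma$-field $\mathcal{B}(\Sigma)$ and $T$ the shift, $T(x_0,x_1,x_2,\dots)=(x_1,x_2,x_3,\dots)$. A process with process measure $P$ on $(\Sigma,\mathcal{B}(\Sigma))$ is AMS if there is a probability measure $\bar P$ such that $\lim_{n\to\infty}\frac1n\sum_{k=0}^{n-1}P(T^{-k}F)=\bar P(F)$ for all $F\in\mathcal{B}(\Sigma)$. $h(x)=-\int p(x)\log_2 p(x)\,dx$ is the differential entropy of a random vector whose law is absolutely continuous with density $p$. *)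

(* Defs.v *)
From HB Require Import structures.
From mathcomp Require Import all_boot all_order all_algebra.
From mathcomp Require Import all_classical all_reals all_analysis.

Set Implicit Arguments.
Unset Strict Implicit.
Unset Printing Implicit Defensive.

Import Order.TTheory GRing.Theory Num.Theory.
Import numFieldNormedType.Exports.

Local Open Scope classical_set_scope.
Local Open Scope ring_scope.

(* Vectors of R^n are row vectors 'rV[R]_n, as for the library's Jacobian 'J.
   R^n carries the sigma-algebra generated by the coordinates, as the library
   does for n.-tuple; it coincides with the Borel sigma-algebra. *)
Definition measure_matrix_display : measure_display.
Proof. exact: default_measure_display. Qed.

Section measurable_matrix.
Context {R : realType} (m n : nat).

Definition mx_measurable : set (set 'M[R]_(m, n)) :=
  <<s \bigcup_(ij in [set: 'I_m * 'I_n])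
        preimage_set_system [set: 'M[R]_(m, n)] (fun A => A ij.1 ij.2)
          (@measurable _ (measurableTypeR R)) >>.

Let mx_measurable0 : mx_measurable set0.
Proof. exact: sigma_algebra0. Qed.

Let mx_measurableC A : mx_measurable A -> mx_measurable (~` A).
Proof. exact: sigma_algebraC. Qed.

Let mx_measurable_bigcup (F : (set 'M[R]_(m, n))^nat) :
  (forall i, mx_measurable (F i)) -> mx_measurable (\bigcup_i (F i)).
Proof. exact: sigma_algebra_bigcup. Qed.

HB.instance Definition _ := @isMeasurable.Build measure_matrix_display
  'M[R]_(m, n) mx_measurable mx_measurable0 mx_measurableC
  mx_measurable_bigcup.

Lemma measurable_mx_coord (i : 'I_m) (j : 'I_n) :
  measurable_fun [set: 'M[R]_(m, n)]
    (fun A => A i j : measurableTypeR R).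
Proof.
move=> _ Y mY; apply: sub_sigma_algebra.
by exists (i, j) => //; exists Y.
Qed.

Lemma measurable_mxP d (T : measurableType d) (g : T -> 'M[R]_(m, n)) :
  (forall i j, measurable_fun [set: T] (fun t => g t i j : measurableTypeR R)) ->
  measurable_fun [set: T] g.
Proof.
move=> mg; apply: (@measurability _ _ _ _ _ _
  (\bigcup_(ij in [set: 'I_m * 'I_n])
        preimage_set_system [set: 'M[R]_(m, n)] (fun A => A ij.1 ij.2)
          (@measurable _ (measurableTypeR R)))) => //.
move=> _ [_ [[i j] _ [Y mY <-]] <-]; rewrite setTI.
by have := mg i j measurableT Y mY.
Qed.

End measurable_matrix.

Section lebesgue.
Context {R : realType}.

Definition cons_rV n (v : measurableTypeR R * 'rV[R]_n) : 'rV[R]_n.+1 :=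
  row_mx (const_mx v.1 : 'rV_1) v.2 : 'rV_(1 + n).

Lemma cons_rV0 n v i : @cons_rV n v i ord0 = v.1.
Proof.
transitivity ((const_mx v.1 : 'rV[R]_1) i ord0); last by rewrite mxE.
rewrite -(row_mxEl (const_mx v.1 : 'rV_1) v.2 i ord0).
by congr (row_mx _ _ _ _); exact: val_inj.
Qed.

Lemma cons_rVS n v i (k : 'I_n) : cons_rV v i (lift ord0 k) = v.2 i k.
Proof.
rewrite -(row_mxEr (const_mx v.1 : 'rV_1) v.2 i k).
by congr (row_mx _ _ _ _); exact: val_inj.
Qed.

Lemma measurable_cons_rV n : measurable_fun setT (@cons_rV n).
Proof.
apply: (measurable_mxP (g := @cons_rV n)) => i j.
case: (unliftP ord0 j) => [k|] ->.
- under eq_fun do rewrite cons_rVS.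
  apply: (measurableT_comp (measurable_mx_coord i k)).
  exact: measurable_snd.
- under eq_fun do rewrite cons_rV0.
  exact: measurable_fst.
Qed.

Definition lebesgue_rVS n (mu : {measure set 'rV[R]_n -> \bar R}) :
    set 'rV[R]_n.+1 -> \bar R :=
  pushforward (@lebesgue_measure R \x^ mu)%E (@cons_rV n).

Section lebesgue_rVS_measure.
Context n (mu : {measure set 'rV[R]_n -> \bar R}).

Let mcons := @measurable_cons_rV n.

Let lebesgue_rVS0 : lebesgue_rVS mu set0 = 0%E.
Proof. by rewrite /lebesgue_rVS /pushforward preimage_set0 measure0. Qed.

Let lebesgue_rVS_ge0 A : (0 <= lebesgue_rVS mu A)%E.
Proof. exact: measure_ge0. Qed.

Let lebesgue_rVS_sigma_additive : semi_sigma_additive (lebesgue_rVS mu).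
Proof. exact: measure_semi_sigma_additive. Qed.

HB.instance Definition _ := isMeasure.Build _ _ _ (lebesgue_rVS mu)
  lebesgue_rVS0 lebesgue_rVS_ge0 lebesgue_rVS_sigma_additive.

End lebesgue_rVS_measure.

Fixpoint lebesgue_rV n : {measure set 'rV[R]_n -> \bar R} :=
  match n with
  | 0 => dirac (0 : 'rV[R]_0)
  | n'.+1 => lebesgue_rVS (lebesgue_rV n')
  end.

Lemma lebesgue_rV_box n (A : 'I_n -> set (measurableTypeR R)) :
  (forall i, measurable (A i)) ->
  lebesgue_rV n [set v | forall i, A i (v 0 i)] =
  (\big[*%E/1%E]_(i < n) lebesgue_measure (A i))%E.
Proof.
elim: n A => [|n IH] A mA /=.
  rewrite big_ord0 diracE mem_set//= => -[].
  by case.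
have mB : measurable [set v : 'rV[R]_n | forall i, A (lift ord0 i) (v 0 i)].
  have -> : [set v : 'rV[R]_n | forall i, A (lift ord0 i) (v 0 i)] =
      \bigcap_(i in [set: 'I_n])
        ((fun v : 'rV[R]_n => v 0 i : measurableTypeR R) @^-1` A (lift ord0 i)).
    by apply/seteqP; split => v /= Av i => [_|]; exact: Av.
  apply: fin_bigcap_measurable => // i _; rewrite -[X in measurable X]setTI.
  exact: measurable_mx_coord.
rewrite big_ord_recl -IH // -product_measure2E //.
rewrite /lebesgue_rVS /pushforward; congr (_ _); apply/seteqP; split => -[r v] /=.
- move=> Av; split=> [|i] /=; first by have := Av ord0; rewrite cons_rV0.
  by have := Av (lift ord0 i); rewrite cons_rVS.
- move=> [/= Ar Av] i; case: (unliftP ord0 i) => [j|] ->.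
    by rewrite cons_rVS.
  by rewrite cons_rV0.
Qed.

End lebesgue.

Definition log2 {R : realType} (r : R) : R := ln r / ln 2.

(* log2 with log2 0 = -oo, whereas ln 0 = 0 in the library *)
Definition elog2 {R : realType} (r : R) : \bar R :=
  (lne r%:E * ((ln 2)^-1)%:E)%E.

Definition log2_jacobian {R : realType} N (f : 'rV[R]_N -> 'rV[R]_N)
    (x : 'rV[R]_N) : \bar R := elog2 `|\det ('J f x)|.

Section differential_entropy.
Context d {T : measurableType d} {R : realType} (P : probability T R) (N : nat).

Definition has_density (X : T -> 'rV[R]_N) (p : 'rV[R]_N -> R) :=
  [/\ measurable_fun [set: 'rV[R]_N] p, forall v, 0 <= p v &
      forall A, measurable A ->
        P (X @^-1` A) = (\int[lebesgue_rV N]_(v in A) (p v)%:E)%E].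

(* When the positive and the negative part of p * log2 p both have infinite
   integral, the library's convention +oo - oo = -oo gives entropy +oo. *)
Definition differential_entropy (p : 'rV[R]_N -> R) : \bar R :=
  (- \int[lebesgue_rV N]_v (p v * log2 (p v))%:E)%E.

End differential_entropy.

Section finite_information.
Context {R : realType} {S A B D : finType} (p : S -> R).

Definition pmf_pr (E : pred S) : R := \sum_(s | E s) p s.

(* As 0 * _ = 0, the values of log2 and of division at 0 play no role. *)
Definition mutual_info (X : S -> A) (Y : S -> B) : R :=
  \sum_(a : A) \sum_(b : B)
    let pab := pmf_pr (fun s => (X s == a) && (Y s == b)) in
    let pa := pmf_pr (fun s => X s == a) in
    let pb := pmf_pr (fun s => Y s == b) in
    pab * log2 (pab / (pa * pb)).

Definition cond_mutual_info (X : S -> A) (Y : S -> B) (Z : S -> D) : R :=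
  \sum_(a : A) \sum_(b : B) \sum_(c : D)
    let pabc := pmf_pr (fun s => [&& X s == a, Y s == b & Z s == c]) in
    let pac := pmf_pr (fun s => (X s == a) && (Z s == c)) in
    let pbc := pmf_pr (fun s => (Y s == b) && (Z s == c)) in
    let pc := pmf_pr (fun s => Z s == c) in
    pabc * log2 ((pabc * pc) / (pac * pbc)).

End finite_information.

Section channel.
Context {R : realType} {M M' : finType}.

(* Conditional laws at time t are functions of sequences, and t is read off
   the length of these sequences:
     Q [:: q_0; ...; q_t] [:: q'_0; ...; q'_(t-1)] b
       = P(q'_t = b | q_[0,t], q'_[0,t-1]),
     pi [:: q_0; ...; q_(t-1)] [:: q'_0; ...; q'_(t-1)] a
       = P(q_t = a | q_[0,t-1], q'_[0,t-1]). *)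
Definition channel_kernel (Q : seq M -> seq M' -> M' -> R) :=
  forall (a : seq M) (b : seq M'), size a = (size b).+1 ->
    (forall y, 0 <= Q a b y) /\ \sum_(y : M') Q a b y = 1.

Definition input_kernel (pi : seq M -> seq M' -> M -> R) :=
  forall (a : seq M) (b : seq M'), size a = size b ->
    (forall y, 0 <= pi a b y) /\ \sum_(y : M) pi a b y = 1.

(* joint law of (q_[0,n-1], q'_[0,n-1]) *)
Definition feedback_law (Q : seq M -> seq M' -> M' -> R)
    (pi : seq M -> seq M' -> M -> R) (n : nat)
    (z : n.-tuple M * n.-tuple M') : R :=
  \prod_(t < n) (pi (take t z.1) (take t z.2) (tnth z.1 t) *
                 Q (take t.+1 z.1) (take t z.2) (tnth z.2 t)).

(* horizon T = n.+1 *)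
Definition directed_info (n : nat)
    (p : n.+1.-tuple M * n.+1.-tuple M' -> R) : R :=
  \sum_(t < n.+1 | (0 < t)%N)
     cond_mutual_info p (fun z => [tuple of take t.+1 z.1])
                        (fun z => tnth z.2 t)
                        (fun z => [tuple of take t z.2])
  + mutual_info p (fun z => tnth z.1 ord0) (fun z => tnth z.2 ord0).

Definition is_feedback_capacity (Q : seq M -> seq M' -> M' -> R) (C : R) :=
  exists m : R^nat,
    (forall n,
      (exists2 pi, input_kernel pi &
         m n = directed_info (@feedback_law Q pi n.+1)) /\
      (forall pi, input_kernel pi ->
         directed_info (@feedback_law Q pi n.+1) <= m n)) /\
    (fun n => (n.+1%:R)^-1 * m n) @ \oo --> C.

End channel.

Section conditional_probability.
Context d {T : measurableType d} {R : realType} (P : probability T R).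

(* h is a version of the conditional probability P(A | G), G a
   sub-sigma-algebra of T *)
Definition is_cond_prob (G : set (set T)) (A : set T) (h : T -> R) :=
  (forall Y : set R, measurable Y -> G (h @^-1` Y)) /\
  (forall E, G E -> P (A `&` E) = (\int[P]_(o in E) (h o)%:E)%E).

End conditional_probability.

(* X_[0,n-1] *)
Definition history {T E : Type} (X : nat -> T -> E) (n : nat) (o : T) : seq E :=
  mkseq (fun i => X i o) n.

(* A random variable with values in a finite alphabet is measurable for the
   discrete sigma-algebra. *)
Definition finite_rv d {T : measurableType d} {F : finType} (X : T -> F) :=
  forall A : set F, measurable (X @^-1` A).

Section noise.
Context d {T : measurableType d} d' {E : measurableType d'} {R : realType}
  (P : probability T R).

Definition mutually_independent (X : nat -> T -> E) :=
  forall (s : seq nat) (A : nat -> set E), uniq s ->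
    (forall i, measurable (A i)) ->
    P (\big[setI/setT]_(i <- s) (X i @^-1` A i)) =
    (\big[*%E/1%E]_(i <- s) P (X i @^-1` A i))%E.

Definition iid (X : nat -> T -> E) (nu : probability E R) :=
  [/\ forall n, measurable_fun [set: T] (X n),
      forall n A, measurable A -> P (X n @^-1` A) = nu A &
      mutually_independent X].

Definition sequence_gen (X : nat -> T -> E) : set (set T) :=
  \bigcup_n preimage_set_system [set: T] (X n) measurable.

(* the random variable Y is independent of the sequence X *)
Definition independent_of_sequence (Y : T -> E) (X : nat -> T -> E) :=
  forall A F, measurable A -> <<s sequence_gen X >> F ->
    P (Y @^-1` A `&` F) = (P (Y @^-1` A) * P F)%E.

End noise.

Section control.
Context d {T : measurableType d} {R : realType} (P : probability T R)
  {N k : nat} {M M' : finType}.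
Implicit Types (x w : nat -> T -> 'rV[R]_N) (u : nat -> T -> 'rV[R]_k)
  (q : nat -> T -> M) (Q : seq M -> seq M' -> M' -> R).

(* On row vectors, B u reads u *m B^T. *)
Definition controlled_system (f : 'rV[R]_N -> 'rV[R]_N) (B : 'M[R]_(N, k))
    x u w :=
  forall n o, x n.+1 o = f (x n o) + u n o *m B^T + w n o.

(* q_t = ge_t(x_[0,t], q'_[0,t-1]) and u_t = g_t(q'_[0,t]); as functions of
   the outputs, which take finitely many values, ge_t and g_t are
   automatically measurable. *)
Definition causal_policy x q (q' : nat -> T -> M') u :=
  (exists ge : forall t : nat, t.+1.-tuple 'rV[R]_N -> t.-tuple M' -> M,
     (forall t y, finite_rv (fun z => ge t z y)) /\
     (forall t o, q t o = ge t [tuple x i o | i < t.+1]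
                               [tuple q' i o | i < t])) /\
  (exists g : forall t : nat, t.+1.-tuple M' -> 'rV[R]_k,
     forall t o, u t o = g t [tuple q' i o | i < t.+1]).

(* sets of the form {(q_[0,t], q'_[0,t-1]) \in A} *)
Definition channel_history q (q' : nat -> T -> M') (t : nat) : set (set T) :=
  preimage_set_system [set: T]
    (fun o => (history q t.+1 o, history q' t o)) [set: set (seq M * seq M')].

Definition channel_output Q q (q' : nat -> T -> M') :=
  forall t (A : {set M'}),
    is_cond_prob P <<s channel_history q q' t >>
      [set o | q' t o \in A]
      (fun o => \sum_(b in A) Q (history q t.+1 o) (history q' t o) b).

(* The first condition says that any version of
   P(q'_t \in A | q_t, q_[0,t-1], q'_[0,t-1]) is a version of
   P(q'_t \in A | q_t, q_[0,t-1], q'_[0,t-1], x_0, w_s, s >= 0). *)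
Definition class_A Q (C : R) (x0 : T -> 'rV[R]_N) w q
    (q' : nat -> T -> M') :=
  (forall t (A : {set M'}) (h : T -> R),
     is_cond_prob P <<s channel_history q q' t >> [set o | q' t o \in A] h ->
     is_cond_prob P
       <<s channel_history q q' t
           `|` preimage_set_system [set: T] x0 measurable
           `|` sequence_gen w >>
       [set o | q' t o \in A] h) /\
  is_feedback_capacity Q C.

End control.

Section ams.
Context {R : realType} {N : nat}.

Definition cylinder_gen : set (set (nat -> 'rV[R]_N)) :=
  \bigcup_n preimage_set_system [set: nat -> 'rV[R]_N] (fun s => s n)
    measurable.

Definition shift (s : nat -> 'rV[R]_N) : nat -> 'rV[R]_N := fun n => s n.+1.

Definition process_measure d {T : measurableType d} (P : probability T R)
    (x : nat -> T -> 'rV[R]_N) (F : set (nat -> 'rV[R]_N)) : \bar R :=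
  P [set o | F (fun n => x n o)].

Definition AMS (mu : set (nat -> 'rV[R]_N) -> \bar R) :=
  exists Pbar : probability (g_sigma_algebraType cylinder_gen) R,
    forall F, <<s cylinder_gen >> F ->
      (fun n => (n%:R^-1)%:E * \sum_(0 <= k < n) mu (iter k shift @^-1` F))%E
        @ \oo --> Pbar F.

End ams.

(* Main.v *)
From HB Require Import structures.
Require Import Defs.
From mathcomp Require Import all_boot all_order all_fingroup all_algebra.
From mathcomp Require Import all_classical all_reals all_analysis.
From mathcomp Require Import measurable_realfun ring lra.

Set Implicit Arguments.
Unset Strict Implicit.
Unset Printing Implicit Defensive.

Import Order.TTheory GRing.Theory Num.Theory.
Import numFieldNormedType.Exports.

Local Open Scope classical_set_scope.
Local Open Scope ring_scope.

(** Write c for 2 to the power of the infimum of log2 |J f|.  The proof is a weak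
converse of Fano type that compares the closed loop with a fictitious one in
which the channel outputs carry no information about the exogenous variables
(x_0, w).

Freeze the outputs q' and the noise w.  Then x_n is obtained from x_0 by n
applications of f interleaved with translations, and since f is injective with
|det J f| >= c everywhere, the set of those x_0 that are sent into a set K has
Lebesgue measure at most c^-n vol(K) ([lebesgue_preimage_le],
[lebesgue_trajectory_le]).  Hence, if q' were independent of (x_0, w), the event
E that x_n lies in K and the density of x_0 is at most kap at x_0 would have
probability at most kap c^-n vol(K) ([prob_trajectory_le]).

In the true closed loop E is likely.  The stationary mean provides a bounded box
K that x_n visits with probability close to 1 for infinitely many n
([cesaro_infinitely_often]), and for kap large the restriction on x_0 costs
little.

The price for moving from the fictitious law to the true one is the directed
information.  The class A property factorizes the probability of a record of
channel uses into the product of the channel kernels and the probability that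
the encoder, run open loop against these outputs, produces these inputs
([Pr_channel_use]); so the density of the true law with respect to the
fictitious one is the product of the kernels divided by the law of the outputs,
and the mean of its logarithm is the directed information ([directed_infoE]).
Gibbs' inequality [gibbs_event] turns this into
    P(E) ln(1/del) - 1 <= ln 2 * I(q -> q')
whenever E has probability at most del under the fictitious law
([directed_info_ge]).  With del = kap c^-n vol(K) the left side is close to
n ln c.  The inputs of the closed loop are generated by some input kernel
([feedback_law_joint]), so the directed information is at most the maximum in
the definition of capacity; dividing by n and letting n go to infinity along the
visits to K gives the claim ([rate_le_limit]) when c > 1.  When c <= 1 the claim
follows from C >= 0, which is the same bound for an impossible event.

The volume inequality is local.  Composed with the inverse of its derivative at a
point, f nearly expands distances in the sup norm around that point
([C1_almost_linear]); the preimage of a cube under an expanding map has small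
diameter, hence small volume, and a comparison of measures on dyadic cubes
extends to all measurable sets ([lebesgue_expanding]).  The derivative
contributes the determinant ([scales_mulmx], by triangular factorization), and
countably many small cubes cover the space ([global_expansion]). *)

(** * Boxes and uniqueness of Lebesgue measure *)

Lemma norm_coord_le {R : realType} m n (A : 'M[R]_(m, n)) i j : `|A i j| <= `|A|.
Proof.
rewrite [leRHS]/Num.norm /= mx_normrE.
by apply/bigmax_geP; right; exists (i, j).
Qed.

Lemma norm_mx_le {R : realType} m n (A : 'M[R]_(m, n)) e :
  0 <= e -> (forall i j, `|A i j| <= e) -> `|A| <= e.
Proof.
move=> e0 Ae; rewrite [leLHS]/Num.norm /= mx_normrE.
by apply/bigmax_leP; split => // -[i j] _; exact: Ae.
Qed.

Definition box {R : realType} N (A : 'I_N -> set (measurableTypeR R)) :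
  set 'rV[R]_N :=
  [set v | forall i, A i (v 0 i)].

Section boxes.
Context {R : realType} {N : nat}.
Implicit Types A : 'I_N -> set (measurableTypeR R).

Lemma measurable_box A :
  (forall i, measurable (A i)) -> measurable (box A).
Proof.
move=> mA.
have -> : box A = \bigcap_(i in [set: 'I_N])
    ((fun v : 'rV[R]_N => v 0 i : measurableTypeR R) @^-1` A i).
  by apply/seteqP; split => v /= Av i => [_|]; exact: Av.
apply: fin_bigcap_measurable => // i _; rewrite -[X in measurable X]setTI.
exact: measurable_mx_coord.
Qed.

Lemma lebesgue_box_fin (r : R) :
  (lebesgue_rV N (box (N := N) (fun=> `[(- r)%R, r]%classic)) < +oo)%E.
Proof.
rewrite lebesgue_rV_box => [|i]; last exact: measurable_itv.
rewrite ltey_eq; apply/orP; left.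
elim/big_ind : _ => [//|a b|i _]; first exact: fin_numM.
by rewrite lebesgue_measure_itv /=; case: ifP.
Qed.

(** Boxes with measurable sides form a pi-system that generates the coordinate
sigma-algebra, and the boxes with sides [-k, k] exhaust the space. *)
Lemma lebesgue_rV_unique (mu : {measure set 'rV[R]_N -> \bar R}) :
  (forall A, (forall i, measurable (A i)) ->
     mu (box A) = (\big[*%E/1%E]_(i < N) lebesgue_measure (A i))%E) ->
  forall S, measurable S -> lebesgue_rV N S = mu S.
Proof.
move=> mubox S mS.
pose G : set (set 'rV[R]_N) :=
  [set X | exists2 B : 'I_N -> set (measurableTypeR R),
     (forall i, measurable (B i)) & X = box B].
apply: (measure_unique G (fun k => box (fun=> `[- k%:R, k%:R]%classic))) => //.
- apply/seteqP; split; last first.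
    by apply: smallest_sub; [exact: sigma_algebra_measurable|
      move=> _ [B mB ->]; exact: measurable_box].
  apply: smallest_sub; first exact: smallest_sigma_algebra.
  move=> _ [[i j] _ [Y mY <-]]; apply: sub_sigma_algebra.
  exists (fun k => if k == j then Y else setT).
    by move=> k; case: ifP.
  apply/seteqP; split => v /=.
    move=> [_ Yv] k; case: eqP => // ->; move: Yv; rewrite /= (ord1 i) //.
  by move=> /(_ j); rewrite eqxx => Yv; split => //; rewrite (ord1 i).
- move=> _ _ [B1 mB1 ->] [B2 mB2 ->].
  exists (fun i => B1 i `&` B2 i); first by move=> i; exact: measurableI.
  apply/seteqP; split => v /=; first by move=> [h1 h2] i; split.
  by move=> h; split => i; have [] := h i.
- move=> k; exists (fun=> `[- k%:R, k%:R]%classic) => //.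
- apply/seteqP; split => // v _.
  exists (Num.bound `|v|) => // i; rewrite /= in_itv /= -ler_norml.
  apply: le_trans (ltW (archi_boundP (normr_ge0 v))).
  exact: norm_coord_le.
- by move=> _ [B mB ->]; rewrite lebesgue_rV_box// mubox.
- by move=> k; exact: lebesgue_box_fin.
Qed.

End boxes.

(** * Affine maps of the line *)

Definition pushforward_measure d1 d2 (T1 : measurableType d1)
    (T2 : measurableType d2) (R : realType) (mu : {measure set T1 -> \bar R})
    (g : T1 -> T2) (mg : measurable_fun setT g) :
    {measure set T2 -> \bar R} :=
  measure_function_pushforward__canonical__measure_function_Measure mu mg.

Lemma pushforward_measureE d1 d2 (T1 : measurableType d1)
    (T2 : measurableType d2) (R : realType) (mu : {measure set T1 -> \bar R})
    (g : T1 -> T2) (mg : measurable_fun setT g) A :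
  pushforward_measure mu mg A = mu (g @^-1` A).
Proof. by []. Qed.

(** It suffices to compare on half-open intervals; a negative slope turns them
around, which changes which endpoint is included but not the length. *)
Lemma lebesgue_affine {R : realType} (a b : R) (A : set (measurableTypeR R)) :
  a != 0 -> measurable A ->
  lebesgue_measure [set r | A (a * r + b)] =
    ((`|a|^-1)%:E * lebesgue_measure A)%E.
Proof.
move=> a0 mA.
have mg : measurable_fun setT
    (fun r : measurableTypeR R => (a * r + b : measurableTypeR R)).
  by apply: measurable_funD => //; exact: measurable_funM.
have na : 0 < `|a| by rewrite normr_gt0.
pose mu := mscale (NngNum (ltW na)) (pushforward_measure lebesgue_measure mg).
have -> : lebesgue_measure A = mu A.
  apply: lebesgue_measure_unique => // _ [[x y] _ <-] /=.
  rewrite /mscale pushforward_measureE /=.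
  have [alt0|agt0|a_eq0] := ltgtP a 0; last by rewrite a_eq0 eqxx in a0.
  - have -> : (fun r : measurableTypeR R => (a * r + b : measurableTypeR R))
        @^-1` `]x, y]%classic = `[(y - b) / a, (x - b) / a[%classic.
      apply/seteqP; split => r /=; rewrite !in_itv /=;
      by rewrite ltr_ndivlMr// ler_ndivrMr// [r * a]mulrC lerBrDr ltrBlDr andbC.
    rewrite !lebesgue_measure_itv /= !lte_fin ltr_nM2r ?invr_lt0// ltrD2r.
    case: ifP => _; last by rewrite mule0.
    by rewrite ltr0_norm// -!EFinB -EFinM; congr EFin; field.
  - have -> : (fun r : measurableTypeR R => (a * r + b : measurableTypeR R))
        @^-1` `]x, y]%classic = `](x - b) / a, (y - b) / a]%classic.
      apply/seteqP; split => r /=; rewrite !in_itv /=;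
      by rewrite ltr_pdivrMr// ler_pdivlMr// [r * a]mulrC lerBrDr ltrBlDr.
    rewrite !lebesgue_measure_itv /= !lte_fin ltr_pM2r ?invr_gt0// ltrD2r.
    case: ifP => _; last by rewrite mule0.
    by rewrite gtr0_norm// -!EFinB -EFinM; congr EFin; field.
rewrite /mu /= /mscale pushforward_measureE muleA -EFinM mulVf ?gt_eqF//.
by rewrite mul1e.
Qed.

(** * Linear maps scale Lebesgue measure by the determinant *)

Section scaling.
Context {R : realType}.

(** For an invertible linear map, c is the inverse of the absolute value of the
determinant. *)
Definition scales N (c : R) (g : 'rV[R]_N -> 'rV[R]_N) :=
  measurable_fun setT g /\ forall S, measurable S ->
    lebesgue_rV N (g @^-1` S) = (c%:E * lebesgue_rV N S)%E.

Lemma scales_comp N c c' (g g' : 'rV[R]_N -> 'rV[R]_N) :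
  scales c g -> scales c' g' -> scales (c * c') (g' \o g).
Proof.
move=> [mg gE] [mg' gE']; split; first exact: measurableT_comp.
move=> S mS; rewrite comp_preimage gE ?gE' ?EFinM ?muleA//.
by rewrite -[X in measurable X]setTI; exact: mg'.
Qed.

Lemma scales_box N (g : 'rV[R]_N -> 'rV[R]_N) :
  measurable_fun setT g ->
  (forall A, (forall i, measurable (A i)) ->
     lebesgue_rV N (g @^-1` box A) =
     (\big[*%E/1%E]_(i < N) lebesgue_measure (A i))%E) ->
  scales 1 g.
Proof.
move=> mg gE; split => // S mS; rewrite mul1e.
by rewrite (lebesgue_rV_unique
  (mu := pushforward_measure (lebesgue_rV N) mg) gE mS).
Qed.

Lemma measurable_addmx d (T : measurableType d) N (g h : T -> 'rV[R]_N) :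
  measurable_fun setT g -> measurable_fun setT h ->
  measurable_fun setT (fun t => g t + h t).
Proof.
move=> mg mh; apply: (@measurable_mxP R 1 N _ T (fun t => g t + h t)) => i j.
under eq_fun do rewrite mxE.
by apply: measurable_funD; apply: (measurableT_comp (measurable_mx_coord i j)).
Qed.

Lemma measurable_mulmx m N (D : 'M[R]_(m, N)) :
  measurable_fun setT (fun v : 'rV[R]_m => v *m D).
Proof.
apply: (measurable_mxP (g := fun v => v *m D)) => i j.
under eq_fun do rewrite mxE.
apply: measurable_sum => k; apply: measurable_funM => //.
exact: measurable_mx_coord.
Qed.

Lemma scales_translation N (t : 'rV[R]_N) : scales 1 (fun v => v + t).
Proof.
apply: scales_box => [|A mA].
  by apply: measurable_addmx => //; exact: measurable_cst.
have -> : (fun v => v + t) @^-1` box A =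
    box (fun i => [set r : measurableTypeR R | A i (1 * r + t 0 i)]).
  by apply/seteqP; split => v /= Av i; have := Av i; rewrite /= !mxE mul1r.
rewrite lebesgue_rV_box => [|i].
  apply: eq_bigr => i _; rewrite lebesgue_affine ?oner_eq0//.
  by rewrite normr1 invr1 mul1e.
have mf : measurable_fun setT
    (fun r : measurableTypeR R => (1 * r + t 0 i : measurableTypeR R)).
  by apply: measurable_funD => //; exact: measurable_funM.
by rewrite -[X in measurable X]setTI; exact: mf.
Qed.

Lemma scales_perm N (s : 'S_N) : scales 1 (fun v => v *m perm_mx s).
Proof.
apply: scales_box => [|A mA]; first exact: measurable_mulmx.
have pE (v : 'rV[R]_N) i : (v *m perm_mx s) 0 i = v 0 ((s^-1)%g i).
  by rewrite -[s in LHS]invgK -col_permE mxE.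
have -> : (fun v : 'rV[R]_N => v *m perm_mx s) @^-1` box A =
    box (fun i => A (s i)).
  apply/seteqP; split => v /= Av i.
    by have := Av (s i); rewrite pE permK.
  by rewrite pE; have := Av ((s^-1)%g i); rewrite permKV.
by rewrite lebesgue_rV_box// [RHS](reindex_inj (@perm_inj _ s)).
Qed.

(** The first coordinate of the image is affine in the first coordinate r of the
argument once the other coordinates v are fixed, and those other coordinates of
the image depend on v alone.  So Fubini separates the two scalings: the sections
shrink by the pivot, and the law of v by the smaller block. *)
Lemma scales_lblock n (a : 'M[R]_1) (c : 'M[R]_(n, 1)) (D : 'M[R]_n) k :
  a 0 0 != 0 -> 0 <= k -> scales k (fun v => v *m D) ->
  scales (`|a 0 0|^-1 * k)
    (fun v : 'rV[R]_n.+1 => v *m (block_mx a 0 c D : 'M[R]_(1 + n)%N)).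
Proof.
move=> a0 k0 [mD DE]; split; first exact: measurable_mulmx.
move=> S mS; set g := fun v => _.
pose S' := @cons_rV R n @^-1` S.
have mS' : measurable S'.
  by rewrite -[X in measurable X]setTI; exact: measurable_cons_rV.
have gE r v : g (cons_rV (r, v)) =
    cons_rV (a 0 0 * r + (v *m c) 0 0, v *m D).
  rewrite /g /cons_rV (mul_row_block (const_mx r : 'rV_1)) mulmx0 add0r/=.
  congr row_mx; apply/rowP => j; rewrite !mxE (ord1 j) big_ord1 !mxE.
  by rewrite mulrC.
have mF := measurable_fun_ysection (@lebesgue_measure R) mS'.
have mg : measurable_fun setT g by exact: measurable_mulmx.
rewrite /= /lebesgue_rVS /pushforward /product_measure2 /=.
transitivity (\int[lebesgue_rV n]_v ((`|a 0 0|^-1)%:E *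
    (lebesgue_measure (ysection S' (v *m D)))))%E.
  apply: eq_integral => v _.
  rewrite -(lebesgue_affine ((v *m c) 0 0))//; last exact: measurable_ysection.
  congr (lebesgue_measure _); apply/seteqP; split => r;
    by rewrite /= /ysection /= !inE /= /S' /= gE.
rewrite ge0_integralZl//; last exact: (measurableT_comp mF mD).
rewrite EFinM -muleA; congr (_ * _)%E.
rewrite -(@ge0_integral_pushforward _ _ _ _ R _ mD (lebesgue_rV n) setT
  (fun v => lebesgue_measure (ysection S' v)))//.
rewrite -[k%:E]/((NngNum k0)%:num%:E) -ge0_integral_mscale//.
by apply: eq_measure_integral => A mA _; exact: DE.
Qed.

Lemma scales_trig n (D : 'M[R]_n) :
  is_trig_mx D -> \det D != 0 -> scales `|\det D|^-1 (fun v => v *m D).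
Proof.
elim: n D => [|n IH] D.
  move=> _ _; rewrite det_mx00 normr1 invr1.
  split => [|S mS]; first exact: measurable_mulmx.
  rewrite mul1e; congr (_ _); apply/seteqP; split => v /=;
  by rewrite (_ : v *m D = v)//; apply/rowP; case.
rewrite -[D](@submxK _ 1 n 1 n) => trigD.
move: (trigD); rewrite (@is_trig_block_mx _ 1 n 1 n)// => /and3P[/eqP-> _ trigD'].
rewrite (@det_lblock _ 1 n) det_mx11 mulf_eq0 negb_or => /andP[a0 D'0].
rewrite normrM invfM; apply: scales_lblock => //; exact: IH.
Qed.

Lemma scales_mulmxM n (D1 D2 : 'M[R]_n) :
  scales `|\det D1|^-1 (fun v => v *m D1) ->
  scales `|\det D2|^-1 (fun v => v *m D2) ->
  scales `|\det (D1 *m D2)|^-1 (fun v => v *m (D1 *m D2)).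
Proof.
move=> s1 s2; rewrite det_mulmx normrM invfM.
by have := scales_comp s1 s2; congr scales; apply/funext => v /=; rewrite mulmxA.
Qed.

Lemma scales_perm_mx n (s : 'S_n) :
  scales `|\det (perm_mx s : 'M[R]_n)|^-1 (fun v => v *m perm_mx s).
Proof. by rewrite det_perm normrX normrN1 expr1n invr1; exact: scales_perm. Qed.

(** By the LUP decomposition.  Permutations preserve boxes, lower triangular
factors are handled by Fubini, and the upper triangular factor becomes lower
triangular after conjugation with the permutation that reverses the
coordinates. *)
Lemma scales_mulmx n (D : 'M[R]_n) :
  \det D != 0 -> scales `|\det D|^-1 (fun v => v *m D).
Proof.
case: n D => [|n] D D0.
  apply: scales_trig => //; apply/is_trig_mxP => -[] //.
have := cormen_lup_correct D; have := cormen_lup_perm D.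
have := cormen_lup_detL D; have := @cormen_lup_lower _ _ D.
have := @cormen_lup_upper _ _ D.
case: cormen_lup => [[P L] U] /= Uu Ll L1 /is_perm_mxP[s ->] DE.
have {}DE : D = perm_mx s^-1 *m (L *m U).
  rewrite [L *m U](_ : _ = perm_mx s *m D); last by rewrite !mulmxE.
  by rewrite mulmxA -perm_mxM mulVg perm_mx1 mul1mx.
have U0 : \det U != 0.
  by apply: contra D0 => /eqP U0; rewrite DE !det_mulmx U0 !mulr0.
rewrite DE; apply: scales_mulmxM; first exact: scales_perm_mx.
apply: scales_mulmxM.
  apply: scales_trig; last by rewrite L1 oner_eq0.
  apply/is_trig_mxP => i j ij; rewrite Ll ?(ltnW ij)//.
  by rewrite -(inj_eq val_inj) /= ltn_eqF.
(* conjugation by the reversal r exchanges upper and lower triangular *)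
pose r : 'S_n.+1 := perm (@rev_ord_inj n.+1).
pose U' := perm_mx r *m U *m perm_mx r^-1.
have UE : U = perm_mx r^-1 *m (U' *m perm_mx r).
  rewrite /U' -!mulmxA -perm_mxM mulVg perm_mx1 mulmx1 mulmxA -perm_mxM mulVg.
  by rewrite perm_mx1 mul1mx.
have U'0 : \det U' != 0.
  by apply: contra U0 => /eqP U'0; rewrite UE 2!det_mulmx U'0 mul0r mulr0.
rewrite UE; apply: scales_mulmxM; first exact: scales_perm_mx.
apply: scales_mulmxM; last exact: scales_perm_mx.
apply: scales_trig => //; apply/is_trig_mxP => i j ij.
rewrite /U' -row_permE -col_permE !mxE !permE Uu//= .
by rewrite ltn_sub2l// ltnS (leq_trans ij)// -ltnS.
Qed.


End scaling.

(** * Comparison of measures on dyadic cubes *)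

Lemma le_cvg {R : realType} (u v : (\bar R)^nat) a b :
  u @ \oo --> a -> v @ \oo --> b -> (forall n, (u n <= v n)%E) -> (a <= b)%E.
Proof.
move=> ua vb uv; rewrite -(cvg_lim _ ua)// -(cvg_lim _ vb)//.
by apply: lee_lim; [exact: cvgP ua|exact: cvgP vb|exact: nearW].
Qed.

(** Once intersected with one of the sets g k, where both measures are finite, the
sets on which the inequality holds form a monotone class, to which the monotone
class theorem applies.  The proper differences that a pi-lambda argument would
need do not preserve an inequality between measures. *)
Lemma measure_le_setring d (T : measurableType d) (R : realType)
    (mu nu : {measure set T -> \bar R}) (G : set (set T)) (g : (set T)^nat) :
  setring G -> measurable = <<s G>> -> (forall k, G (g k)) ->
  nondecreasing_seq g -> \bigcup_k g k = setT ->
  (forall k, (nu (g k) < +oo)%E) -> (forall A, G A -> (mu A <= nu A)%E) ->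
  forall A, measurable A -> (mu A <= nu A)%E.
Proof.
move=> rG mG Gg ndg gT nug le A mA.
have Gm X : G X -> measurable X.
  by rewrite mG => GX; exact: sub_sigma_algebra.
have mg k : measurable (g k) by exact: Gm.
have muK k : (mu (g k) < +oo)%E by apply: le_lt_trans (nug k); exact: le.
pose H k := [set X | measurable X /\ (mu (X `&` g k) <= nu (X `&` g k))%E].
have HA k : H k A.
  have : <<sr G>> A.
    move: mA; rewrite mG; apply: smallest_sub; last exact: sub_g_sigma_ring.
    have [s0 sD sU] := smallest_sigma_ring G; split => // X srX.
    by apply: sD => //; rewrite -gT; apply: sU => i; exact: sub_g_sigma_ring.
  apply: monotone_setring_sub_g_sigma_ring => //; last first.
    move=> X GX; split; first exact: Gm.
    apply: le; case: rG => _ _ GD.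
    by rewrite -setDD; apply: (GD) => //; exact: (GD).
  split => F mF HF.
  - have mFi i : measurable (F i) by have [] := HF i.
    split; first exact: bigcup_measurable.
    have ndF : nondecreasing_seq (fun i => F i `&` g k).
      by move=> i j ij; apply/subsetPset; apply: setSI; apply/subsetPset/mF.
    have mFg i : measurable (F i `&` g k) by exact: measurableI.
    rewrite setI_bigcupl.
    have c1 := nondecreasing_cvg_mu (mu := mu) mFg (bigcupT_measurable _ mFg) ndF.
    have c2 := nondecreasing_cvg_mu (mu := nu) mFg (bigcupT_measurable _ mFg) ndF.
    by apply: (le_cvg c1 c2) => i; have [] := HF i.
  - have mFi i : measurable (F i) by have [] := HF i.
    split; first exact: bigcap_measurable.
    have niF : nonincreasing_seq (fun i => F i `&` g k).
      by move=> i j ij; apply/subsetPset; apply: setSI; apply/subsetPset/mF.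
    have mFg i : measurable (F i `&` g k) by exact: measurableI.
    have -> : (\bigcap_i F i) `&` g k = \bigcap_i (F i `&` g k).
      apply/seteqP; split => x /=.
        by move=> [h1 h2] i _; split => //; exact: h1.
      by move=> h; split; [move=> i _; have [] := h i I|have [] := h 0%N I].
    have fin (m : {measure set T -> \bar R}) :
        (m (g k) < +oo)%E -> (m (F 0%N `&` g k) < +oo)%E.
      by apply: le_lt_trans; apply: le_measure; rewrite ?inE//; exact: subIsetr.
    have c1 := nonincreasing_cvg_mu (mu := mu) (fin _ (muK k)) mFg
      (bigcapT_measurable mFg) niF.
    have c2 := nonincreasing_cvg_mu (mu := nu) (fin _ (nug k)) mFg
      (bigcapT_measurable mFg) niF.
    by apply: (le_cvg c1 c2) => i; have [] := HF i.
have AE : A = \bigcup_k (A `&` g k) by rewrite -setI_bigcupr gT setIT.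
have ndA : nondecreasing_seq (fun i => A `&` g i).
  by move=> i j ij; apply/subsetPset; apply: setIS; apply/subsetPset/ndg.
have mAg i : measurable (A `&` g i) by exact: measurableI.
have c1 := nondecreasing_cvg_mu (mu := mu) mAg (bigcupT_measurable _ mAg) ndA.
have c2 := nondecreasing_cvg_mu (mu := nu) mAg (bigcupT_measurable _ mAg) ndA.
rewrite AE; apply: (le_cvg c1 c2) => i; have [] := HA i => //.
Qed.

Section dyadic.
Context {R : realType} {N : nat}.
Implicit Types (x y v : 'rV[R]_N) (n m : nat).

Definition dyadic_index n x : 'rV[int]_N :=
  map_mx (fun r => Num.floor (2 ^+ n * r)) x.

(** The sets of level n are the unions of dyadic cubes of side 2 ^- n.  They are
described by invariance rather than as unions, so that passing to a finer level
is immediate and the union over all levels is visibly a ring of sets. *)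
Definition dyadic_set n (X : set 'rV[R]_N) :=
  forall x y, dyadic_index n x = dyadic_index n y -> X x -> X y.

(** Comparing 2 ^ n r with an integer z amounts to comparing 2 ^ m r with the integer
2 ^ (m - n) z, so the floor of 2 ^ m r determines that of 2 ^ n r. *)
Lemma dyadic_indexW n m x y : (n <= m)%N ->
  dyadic_index m x = dyadic_index m y -> dyadic_index n x = dyadic_index n y.
Proof.
move=> nm /rowP xy; apply/rowP => i; have := xy i; rewrite !mxE => {}xy.
suff le (r s : R) : Num.floor (2 ^+ m * r) = Num.floor (2 ^+ m * s) ->
    Num.floor (2 ^+ n * r) <= Num.floor (2 ^+ n * s) :> int.
  by apply/eqP; rewrite eq_le !le.
move=> rs; rewrite floor_ge_int.
have : ((2 ^+ (m - n) * Num.floor (2 ^+ n * r)) : int) <= Num.floor (2 ^+ m * s).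
  rewrite -rs floor_ge_int intrM rmorphXn/= -(subnK nm) addnK exprD -mulrA.
  by rewrite ler_pM2l ?exprn_gt0//; exact: floor_le_tmp.
rewrite floor_ge_int intrM rmorphXn/= -(subnK nm) addnK exprD -mulrA.
by rewrite ler_pM2l ?exprn_gt0.
Qed.

Lemma dyadic_setW n m X : (n <= m)%N -> dyadic_set n X -> dyadic_set m X.
Proof. by move=> nm nX x y /(dyadic_indexW nm); exact: nX. Qed.

Definition dyadic_sets : set (set 'rV[R]_N) := [set X | exists n, dyadic_set n X].

Lemma setring_dyadic : setring dyadic_sets.
Proof.
split.
- by exists 0%N => x y.
- move=> A B [n nA] [m mB]; exists (maxn n m) => x y xy [Ax|Bx].
    by left; apply: (dyadic_setW (leq_maxl n m) nA xy).
  by right; apply: (dyadic_setW (leq_maxr n m) mB xy).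
- move=> A B [n nA] [m mB]; exists (maxn n m) => x y xy [Ax Bx]; split.
    by apply: (dyadic_setW (leq_maxl n m) nA xy).
  by move=> By; apply: Bx; apply: (dyadic_setW (leq_maxr n m) mB (esym xy)).
Qed.

Definition dyadic_cube n (z : 'rV[int]_N) := [set x | dyadic_index n x = z].

Lemma dyadic_cubeE n z : dyadic_cube n z =
  box (fun i => `[(z 0 i)%:~R / 2 ^+ n, ((z 0 i)%:~R + 1) / 2 ^+ n[%classic).
Proof.
have n0 : 0 < 2 ^+ n :> R by rewrite exprn_gt0.
apply/seteqP; split => x /=.
  move=> <- i; rewrite /= in_itv /= mxE ler_pdivrMr// ltr_pdivlMr//.
  rewrite [x 0 i * _]mulrC.
  by have := floor_itv (2 ^+ n * x 0 i); rewrite intrD.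
move=> xz; apply/rowP => i; rewrite mxE; apply: floor_def.
have := xz i; rewrite /= in_itv /= ler_pdivrMr// ltr_pdivlMr// mulrC.
by rewrite intrD.
Qed.

Lemma measurable_dyadic_cube n z : measurable (dyadic_cube n z).
Proof.
by rewrite dyadic_cubeE; apply: measurable_box => i; exact: measurable_itv.
Qed.

Lemma lebesgue_dyadic_cube n z :
  lebesgue_rV N (dyadic_cube n z) = ((2 ^- n) ^+ N)%:E.
Proof.
rewrite dyadic_cubeE lebesgue_rV_box => [|i]; last exact: measurable_itv.
rewrite (eq_bigr (fun=> (2 ^- n)%:E)) => [|i _].
  elim: N => [|k IH]; first by rewrite big_ord0 expr0.
  by rewrite big_ord_recl IH -EFinM exprS.
rewrite lebesgue_measure_itv /= lte_fin ltr_pM2r ?invr_gt0 ?exprn_gt0//.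
by rewrite ltrDl ltr01 -EFinB -mulrBl addrAC subrr add0r mul1r.
Qed.

Lemma dyadic_set_bigcup n X :
  X = \bigcup_k (X `&` [set x | pickle (dyadic_index n x) = k]).
Proof.
apply/seteqP; split => x; last by move=> [k _ []].
by move=> Xx; exists (pickle (dyadic_index n x)).
Qed.

(** Numbering the cubes by [pickle] turns the decomposition of a set into cubes into
a sequence, some terms of which are empty. *)
Lemma dyadic_piece n X k : dyadic_set n X ->
  X `&` [set x | pickle (dyadic_index n x) = k] = set0 \/
  exists z, X `&` [set x | pickle (dyadic_index n x) = k] = dyadic_cube n z.
Proof.
move=> nX; set Y := _ `&` _.
have [->|/set0P[x [Xx xk]]] := eqVneq Y set0; [by left|right].
exists (dyadic_index n x); apply/seteqP; split => y /=.
  by move=> [_ yk]; apply: (pcan_inj pickleK); rewrite yk.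
by move=> yx; split; [exact: nX Xx|rewrite /= yx].
Qed.

Lemma measurable_dyadic_piece n X k : dyadic_set n X ->
  measurable (X `&` [set x | pickle (dyadic_index n x) = k]).
Proof.
move=> /(dyadic_piece k)[->//|[z ->]]; exact: measurable_dyadic_cube.
Qed.

Lemma measurable_dyadic_set n X : dyadic_set n X -> measurable X.
Proof.
move=> nX; rewrite (dyadic_set_bigcup n X); apply: bigcupT_measurable => k.
exact: measurable_dyadic_piece.
Qed.

Lemma dyadic_set_le (mu nu : {measure set 'rV[R]_N -> \bar R}) n X :
  (forall z, (mu (dyadic_cube n z) <= nu (dyadic_cube n z))%E) ->
  dyadic_set n X -> (mu X <= nu X)%E.
Proof.
move=> le nX; rewrite (dyadic_set_bigcup n X).
have mX k : measurable (X `&` [set x | pickle (dyadic_index n x) = k]).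
  exact: measurable_dyadic_piece.
rewrite !measure_bigcup//; try by move=> i j _ _ [x [[_ <-] [_ <-]]].
apply: lee_nneseries => [//|k _].
by have [->|[z ->]] := dyadic_piece k nX; [rewrite !measure0|exact: le].
Qed.

(** The half-line r < x i j is detected at a finite level: it holds as soon as
2 ^ n (x i j - r) >= 1 for some n, and then the floor of 2 ^ n x i j already exceeds
2 ^ n r. *)
Lemma measurable_dyadicE :
  @measurable _ 'rV[R]_N = <<s dyadic_sets >>.
Proof.
apply/seteqP; split; last first.
  apply: smallest_sub; first exact: sigma_algebra_measurable.
  by move=> X [n]; exact: measurable_dyadic_set.
apply: smallest_sub; first exact: smallest_sigma_algebra.
move=> _ [[i j] _ [Y mY <-]].
have : measurable_fun [set: g_sigma_algebraType dyadic_sets]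
    (fun x : 'rV[R]_N => x i j : measurableTypeR R).
  move=> mT; apply: (measurability _ (RGenOInfty.measurableE R)) => //.
  move=> _ [_ [r ->] <-]; rewrite setTI.
  have -> : (fun x : 'rV[R]_N => x i j) @^-1` `]r, +oo[ = \bigcup_n
      [set x : 'rV[R]_N | 2 ^+ n * r < (Num.floor (2 ^+ n * x i j))%:~R].
    apply/seteqP; split => x /=; rewrite in_itv /= andbT.
      move=> rx; pose e := x i j - r; have e0 : 0 < e by rewrite subr_gt0.
      have [n ne] : exists n, 1 <= 2 ^+ n * e.
        exists (Num.bound e^-1); rewrite -ler_pdivrMr// div1r.
        by apply: ltW; exact: upper_nthrootP.
      exists n => //=; have /andP[_] := floor_itv (2 ^+ n * x i j).
      rewrite intrD -ltrBlDr; apply: le_lt_trans.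
      by rewrite lerBrDr -lerBrDl -mulrBr.
    move=> [n _ /= /lt_le_trans]/(_ _ (ge_floor _)).
    by rewrite ltr_pM2l ?exprn_gt0.
  apply: bigcupT_measurable => n; apply: sub_sigma_algebra; exists n => x y.
  by move=> /rowP/(_ j); rewrite !mxE /= (ord1 i) => ->.
by move=> /(_ measurableT Y mY).
Qed.

Lemma measure_le_dyadic (mu nu : {measure set 'rV[R]_N -> \bar R}) :
  (forall n z, (mu (dyadic_cube n z) <= nu (dyadic_cube n z))%E) ->
  (forall r : R, (nu (box (fun=> `[(- r)%R, r]%classic)) < +oo)%E) ->
  forall A, measurable A -> (mu A <= nu A)%E.
Proof.
move=> le nuoo.
pose g k := [set x : 'rV[R]_N | forall i, - k%:R <= x 0 i < k%:R].
have Gg k : dyadic_sets (g k).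
  exists 0%N => x y /rowP xy xk i; have := xk i.
  have := xy i; rewrite !mxE expr0 !mul1r => {}xy.
  rewrite -[k%:R]/(k%:Z%:~R) -rmorphN /= -!floor_ge_int xy.
  by rewrite -!floor_lt_int xy.
apply: (measure_le_setring (G := dyadic_sets) (g := g)) => //.
- exact: setring_dyadic.
- exact: measurable_dyadicE.
- move=> k l kl; apply/subsetPset => x xk i; have /andP[h1 h2] := xk i.
  apply/andP; split; first by apply: le_trans h1; rewrite lerN2 ler_nat.
  by apply: (lt_le_trans h2); rewrite ler_nat.
- apply/seteqP; split => // x _; exists (Num.bound `|x|) => //= i.
  have : `|x 0 i| < (Num.bound `|x|)%:R.
    by apply: le_lt_trans (archi_boundP (normr_ge0 x)); exact: norm_coord_le.
  by rewrite ltr_norml => /andP[/ltW -> ->].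
- move=> k; apply: le_lt_trans (nuoo k%:R).
  apply: le_measure; rewrite ?inE.
  + by have [n] := Gg k; exact: measurable_dyadic_set.
  + by apply: measurable_box => i; exact: measurable_itv.
  + by move=> x xk i; rewrite /= in_itv /=; have /andP[-> /ltW ->] := xk i.
- by move=> A [n]; apply: dyadic_set_le.
Qed.

End dyadic.

(** * Locally expanding maps *)

Section lipschitz.
Context {R : realType} {N : nat}.
Implicit Types (E K : set 'rV[R]_N).

(** A set of sup-norm diameter s fits in the box whose i-th side starts at the
infimum of the i-th coordinates and has length s. *)
Lemma lebesgue_diameter E s : measurable E -> 0 <= s ->
  (forall x y, E x -> E y -> `|x - y| <= s) ->
  (lebesgue_rV N E <= (s ^+ N)%:E)%E.
Proof.
move=> mE s0 Es; have [->|/set0P[x0 Ex0]] := eqVneq E set0.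
  by rewrite measure0 lee_fin exprn_ge0.
have Es' i x y : E x -> E y -> x 0 i - y 0 i <= s.
  move=> Ex Ey; apply: le_trans (Es _ _ Ex Ey); apply: le_trans (ler_norm _) _.
  by have := norm_coord_le (x - y) 0 i; rewrite !mxE.
pose a i := inf [set x 0 i | x in E].
have hi i : has_inf [set x 0 i | x in E].
  split; first by exists (x0 0 i), x0.
  exists (x0 0 i - s) => _ [x Ex <-]; rewrite lerBlDr addrC -lerBlDr.
  exact: Es'.
have sub : E `<=` box (fun i => `[a i, a i + s]%classic).
  move=> x Ex i; rewrite /= in_itv /=; apply/andP; split.
    by apply: ge_inf; [exact: (hi i).2|exists x].
  rewrite -lerBlDr; apply: lb_le_inf; first exact: (hi i).1.
  by move=> _ [y Ey <-]; rewrite lerBlDr addrC -lerBlDr; exact: Es'.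
apply: (@le_trans _ _ (lebesgue_rV N (box (fun i => `[a i, a i + s]%classic)))).
  apply: le_measure => //; rewrite inE//.
  by apply: measurable_box => i; exact: measurable_itv.
rewrite lebesgue_rV_box => [|i]; last exact: measurable_itv.
rewrite (eq_bigr (fun=> s%:E)) => [|i _].
  elim: (N) => [|k IH]; first by rewrite big_ord0 expr0.
  by rewrite big_ord_recl exprS EFinM; apply: lee_wpmul2l; rewrite ?lee_fin.
rewrite lebesgue_measure_itv /= lte_fin -EFinB addrAC subrr add0r.
by rewrite ltrDl lt_neqAle s0 andbT eq_sym; case: eqP => // ->.
Qed.

(** The preimage in K of a cube of side s has diameter at most s / th, hence volume at
most s ^ N / th ^ N, which is the asserted inequality for cubes; the comparison on
dyadic cubes does the rest. *)
Lemma lebesgue_expanding K (h : 'rV[R]_N -> 'rV[R]_N) th A :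
  measurable K -> measurable_fun setT h -> 0 < th ->
  (forall x y, K x -> K y -> th * `|x - y| <= `|h x - h y|) ->
  measurable A ->
  (lebesgue_rV N (K `&` h @^-1` A) <= (th ^- N)%:E * lebesgue_rV N A)%E.
Proof.
move=> mK mh th0 hK mA.
have k0 : 0 <= th ^- N by rewrite invr_ge0 exprn_ge0// ltW.
pose mu := pushforward_measure (mrestr (lebesgue_rV N) mK) mh.
pose nu := mscale (NngNum k0) (lebesgue_rV N).
have : (mu A <= nu A)%E.
  apply: measure_le_dyadic => // [n z|r]; last first.
    by rewrite /nu /= /mscale /= lte_mul_pinfty// ?lee_fin// lebesgue_box_fin.
  rewrite /nu /mu /= /mscale /pushforward /mrestr /= lebesgue_dyadic_cube.
  rewrite -EFinM -[(th ^+ N)^-1]exprVn -exprMn; apply: lebesgue_diameter.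
  - apply: measurableI => //; rewrite -[X in measurable X]setTI.
    by apply: (mh) => //; exact: measurable_dyadic_cube.
  - by rewrite mulr_ge0 ?invr_ge0 ?exprn_ge0// ltW.
  - move=> x y [hx Kx] [hy Ky].
    rewrite ler_pdivlMl//; apply: le_trans (hK _ _ Kx Ky) _.
    have n0 : 0 < 2 ^+ n :> R by rewrite exprn_gt0.
    apply: norm_mx_le => [|i j]; first by rewrite invr_ge0 ltW.
    rewrite (ord1 i) !mxE.
    move: hx hy; rewrite /= !dyadic_cubeE => /(_ j) + /(_ j).
    rewrite /= !in_itv /= !mulrDl !mul1r => /andP[a1 a2] /andP[b1 b2].
    rewrite ler_norml; lra.
by rewrite /mu /nu /= /mscale /pushforward /mrestr /= setIC.
Qed.

Lemma norm_mulmx_le m n l (A : 'M[R]_(m, n)) (B : 'M[R]_(n, l)) :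
  `|A *m B| <= n%:R * `|A| * `|B|.
Proof.
apply: norm_mx_le => [|i j]; first by rewrite !mulr_ge0.
rewrite mxE; apply: le_trans (ler_norm_sum _ _ _) _.
rewrite -mulrA mulr_natl -[X in _ *+ X]card_ord -sumr_const.
by apply: ler_sum => k _; rewrite normrM ler_pM// norm_coord_le.
Qed.

Lemma is_derive_coord_line (f : 'rV[R]_N -> 'rV[R]_N) (E : 'M[R]_N) y v j t :
  differentiable f (y + t *: v) ->
  is_derive t 1 (fun s => (f (y + s *: v) *m E) 0 j)
    ((v *m ('J f (y + t *: v) *m E)) 0 j).
Proof.
move=> df; have dfv : derivable f (y + t *: v) v by exact: diff_derivable.
have cE : continuous (fun z : 'rV[R]_N => (z *m E) 0 j).
  move=> z; apply/(@cvgrPdist_le _ _ _ _ (nbhs_filter z)) => /= e e0.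
  (* N |E| bounds the operator norm of z |-> z E; adding 1 makes k positive *)
  pose k := N%:R * `|E| + 1; have k0 : 0 < k by rewrite ltr_wpDl// mulr_ge0.
  apply/nbhs_ballP; exists (e / k); first by rewrite /= divr_gt0.
  move=> z'; rewrite -ball_normE /= => /ltW zz'.
  have -> : (z *m E) 0 j - (z' *m E) 0 j = ((z - z') *m E) 0 j.
    by rewrite mulmxBl !mxE.
  apply: le_trans (norm_coord_le _ _ _) _; apply: le_trans (norm_mulmx_le _ _) _.
  rewrite mulrAC; apply: (@le_trans _ _ (k * (e / k))); last first.
    by rewrite mulrC divfK// gt_eqF.
  by apply: ler_pM => //; rewrite ?mulr_ge0// lerDl.
have qE : (fun h => h^-1 *: (((fun s => (f (y + s *: v) *m E) 0 j) \o shift t)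
      (h *: 1) - (f (y + t *: v) *m E) 0 j)) =
    (fun z : 'rV[R]_N => (z *m E) 0 j) \o
    (fun h => h^-1 *: ((f \o shift (y + t *: v)) (h *: v) - f (y + t *: v))).
  apply/funext => h /=; rewrite -scalemxAl mulmxBl !mxE /=.
  congr (_ * (_ - _)); apply: eq_bigr => k _; congr (f _ _ _ * _).
  by rewrite [h *: 1]mulr1 scalerDl addrCA.
have cq : h^-1 *: (((fun s => (f (y + s *: v) *m E) 0 j) \o shift t)
      (h *: 1) - (f (y + t *: v) *m E) 0 j) @[h --> 0^'] -->
    (('D_v f (y + t *: v)) *m E) 0 j.
  by rewrite qE; apply: continuous_cvg => //; exact: cE.
apply: DeriveDef; first exact: cvgP cq.
by rewrite mulmxA -deriveEjacobian//; exact: (cvg_lim _ cq).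
Qed.

(** The map z |-> f z D^-1 - z, with D the Jacobian matrix at x0, has a derivative
that vanishes at x0 and is continuous, so by the mean value theorem on
segments it is eta-Lipschitz near x0. *)
Lemma C1_almost_linear (f : 'rV[R]_N -> 'rV[R]_N) x0 eta :
  (forall v, differentiable f v) -> continuous (fun v => 'J f v) ->
  \det ('J f x0) != 0 -> 0 < eta ->
  exists2 r, 0 < r & forall x y, `|x - x0| < r -> `|y - x0| < r ->
    (1 - eta) * `|x - y| <=
    `|f x *m invmx ('J f x0) - f y *m invmx ('J f x0)|.
Proof.
move=> df cJ det0 eta0; set D := 'J f x0; set E := invmx D.
have uD : D \in unitmx by rewrite unitmxE unitfE.
(* One factor N comes from multiplying by E, the other from multiplying by the
row vector v in the mean value formula. *)
pose k := N%:R * N%:R * `|E| + 1.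
have k0 : 0 < k by rewrite ltr_wpDl// !mulr_ge0.
have /cvgrPdist_lt/(_ (eta / k)) := cJ x0.
rewrite divr_gt0// => /(_ isT)/nbhs_ballP[r /= r0 rJ].
exists r => // x y xr yr.
pose v := x - y.
have seg t : 0 <= t <= 1 -> `|'J f (y + t *: v) *m E - 1%:M| * N%:R <= eta.
  move=> /andP[t0 t1].
  have : ball x0 r (y + t *: v).
    rewrite -ball_normE /=.
    have -> : x0 - (y + t *: v) = (1 - t) *: (x0 - y) + t *: (x0 - x).
      rewrite /v scalerBl scale1r !scalerBr addrAC; apply/rowP => i.
      by rewrite !mxE; ring.
    apply: le_lt_trans (ler_normD _ _) _; rewrite !normrZ !ger0_norm ?subr_ge0//.
    rewrite [`|x0 - y|]distrC [`|x0 - x|]distrC.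
    have [->|t_gt0] := eqVneq t 0; first by rewrite subr0 mul1r mul0r addr0.
    have {}t_gt0 : 0 < t by rewrite lt_neqAle eq_sym t_gt0.
    have : t * `|x - x0| < t * r by rewrite ltr_pM2l.
    have : (1 - t) * `|y - x0| <= (1 - t) * r by rewrite ler_wpM2l ?subr_ge0// ltW.
    move=> h1 h2; lra.
  move=> /rJ /= /ltW; rewrite -/D distrC => JD.
  rewrite -(mulmxV uD) -mulmxBl.
  apply: (@le_trans _ _ (N%:R * (eta / k) * `|E| * N%:R)).
    apply: ler_wpM2r => //; apply: le_trans (norm_mulmx_le _ _) _.
    by apply: ler_wpM2r => //; exact: ler_wpM2l.
  rewrite (_ : _ * N%:R = eta * ((k - 1) / k)); last by rewrite /k; ring.
  rewrite ler_piMr ?(ltW eta0)// ler_pdivrMr// mul1r; lra.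
(* the reverse triangle inequality turns eta-closeness to x - y into expansion *)
suff near_id : `|(f x *m E - f y *m E) - (x - y)| <= eta * `|x - y|.
  have := ler_normB (f x *m E - f y *m E) ((f x *m E - f y *m E) - (x - y)).
  rewrite opprB addrC subrK => h; rewrite mulrBl mul1r lerBlDr.
  by apply: (le_trans h); rewrite lerD2l.
apply: norm_mx_le => [|i j]; first by rewrite mulr_ge0// ltW.
rewrite (ord1 i) {i}.
pose g t := (f (y + t *: v) *m E) 0 j - t * v 0 j.
have dg (t : R) : is_derive t 1 g ((v *m ('J f (y + t *: v) *m E)) 0 j - v 0 j).
  have h1 := is_derive_coord_line E j (df (y + t *: v)).
  have h2 : is_derive t 1 (fun s : R => s * v 0 j) (v 0 j).
    rewrite (_ : (fun s : R => s * v 0 j) = (v 0 j : R) \*: (id : R -> R)).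
      apply: is_derive_eq; rewrite [_ *: _]mulr1 //.
    by apply/funext => s /=; rewrite mulrC.
  exact: is_deriveB.
have [c c01 gc] : exists2 c, c \in `[0, 1]%R & g 1 - g 0 =
    ((v *m ('J f (y + c *: v) *m E)) 0 j - v 0 j) * (1 - 0).
  apply: MVT_segment => //.
  apply: derivable_within_continuous => t _.
  by have [] := dg t.
have -> : (f x *m E - f y *m E - (x - y)) 0 j = g 1 - g 0.
  have yv : y + v = x by rewrite /v addrC subrK.
  rewrite /g scale1r yv scale0r addr0 mul0r subr0 mul1r ![in LHS]mxE /v !mxE.
  by ring.
rewrite gc subr0 mulr1.
have -> : (v *m ('J f (y + c *: v) *m E)) 0 j - v 0 j =
    (v *m ('J f (y + c *: v) *m E - 1%:M)) 0 j.
  by rewrite mulmxBr mulmx1 !mxE.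
apply: le_trans (norm_coord_le _ _ _) _; apply: le_trans (norm_mulmx_le _ _) _.
rewrite -/v mulrC mulrA; apply: ler_wpM2r => //; apply: seg.
by move: c01; rewrite in_itv.
Qed.

End lipschitz.

(** * Volume expansion under a lower bound on the Jacobian determinant *)

Section volume_expansion.
Context {R : realType} {N : nat}.

Definition closed_cube n (z : 'rV[int]_N) : set 'rV[R]_N :=
  box (fun i => `[(z 0 i)%:~R / 2 ^+ n, ((z 0 i)%:~R + 1) / 2 ^+ n]%classic).

Lemma closed_cube_index n (x : 'rV[R]_N) : closed_cube n (dyadic_index n x) x.
Proof.
have : dyadic_cube n (dyadic_index n x) x by [].
rewrite dyadic_cubeE => xz i; have := xz i.
by rewrite /= !in_itv /= => /andP[-> /ltW ->].
Qed.

Lemma closed_cube_dist n z (x y : 'rV[R]_N) :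
  closed_cube n z x -> closed_cube n z y -> `|x - y| <= 2 ^- n.
Proof.
move=> zx zy; have n0 : 0 < 2 ^+ n :> R by rewrite exprn_gt0.
apply: norm_mx_le => [|i j]; first by rewrite invr_ge0 ltW.
rewrite (ord1 i) !mxE; have := zx j; have := zy j.
rewrite /= !in_itv /= !mulrDl !mul1r => /andP[a1 a2] /andP[b1 b2].
rewrite ler_norml; lra.
Qed.

(** An open set is the union of the countably many dyadic cubes that it contains. *)
Lemma open_rV_measurable (U : set 'rV[R]_N) : open U -> measurable U.
Proof.
move=> oU.
have -> : U = \bigcup_k (if unpickle k is Some (n, z) then
    if pselect (dyadic_cube n z `<=` U) then dyadic_cube n z else set0
    else set0).
  apply/seteqP; split => x; last first.
    move=> [k _]; case: unpickle => [[n z]|//].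
    by case: pselect => // sub /sub.
  move=> Ux; have /nbhs_ballP[e /= e0 eU] := open_nbhs_nbhs (conj oU Ux).
  (* 2 ^ n > e^-1, so that the cubes of level n have side less than e *)
  pose n := Num.bound e^-1.
  exists (pickle (n, dyadic_index n x)) => //; rewrite pickleK.
  case: pselect => [? //|[]] y yx; apply: eU; rewrite -ball_normE /=.
  have xy : `|x - y| <= 2 ^- n.
    apply: (@closed_cube_dist n (dyadic_index n x)); first exact: closed_cube_index.
    by rewrite -yx; exact: closed_cube_index.
  apply: le_lt_trans xy _; rewrite -[e]invrK ltf_pV2 ?posrE ?invr_gt0 ?exprn_gt0//.
  exact: upper_nthrootP.
apply: bigcupT_measurable => k; case: unpickle => [[n z]|//].
by case: pselect => [?|?] /=; [exact: measurable_dyadic_cube|].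
Qed.

Lemma closed_rV_measurable (F : set 'rV[R]_N) : closed F -> measurable F.
Proof.
by move=> cF; rewrite -[F]setCK; apply: measurableC; apply: open_rV_measurable;
  exact: closed_openC.
Qed.

Lemma compact_closed_cube n z : compact (closed_cube n z).
Proof.
apply: (@rV_compact R N (fun i => `[(z 0 i)%:~R / 2 ^+ n,
  ((z 0 i)%:~R + 1) / 2 ^+ n]%classic)) => i.
exact: segment_compact.
Qed.

Lemma measurable_closed_cube n z : measurable (closed_cube n z).
Proof. by apply: measurable_box => i; exact: measurable_itv. Qed.

Section global.
Variables (f : 'rV[R]_N -> 'rV[R]_N) (c : R).
Hypotheses (mf : measurable_fun [set: 'rV[R]_N] f)
  (df : forall v, differentiable f v) (cJ : continuous (fun v => 'J f v))
  (injf : injective f) (c0 : 0 < c) (detc : forall x, c <= `|\det ('J f x)|).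

Lemma measurable_preimage_f A : measurable A -> measurable (f @^-1` A).
Proof. by move=> mA; rewrite -[X in measurable X]setTI; exact: mf. Qed.

Let kappa (eta : R) := ((1 - eta) ^- N / c)%:E.

Let good eta K := forall A, measurable A ->
  (lebesgue_rV N (K `&` f @^-1` A) <= kappa eta * lebesgue_rV N A)%E.

(** Near x0, f is a nearly expanding map followed by the linear map D = J f x0, and the
two effects on volumes multiply. *)
Lemma local_expansion eta (x0 : 'rV[R]_N) : 0 < eta < 1 ->
  exists n, good eta (closed_cube n (dyadic_index n x0)).
Proof.
move=> /andP[eta0 eta1].
have D0 : \det ('J f x0) != 0.
  by rewrite -normr_gt0; exact: lt_le_trans c0 (detc x0).
have [r r0 rf] := C1_almost_linear df cJ D0 eta0.
(* 2 ^ n > r^-1, so that the cubes of level n have side less than r *)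
pose n := Num.bound r^-1; exists n => A mA.
have near (x : 'rV[R]_N) : closed_cube n (dyadic_index n x0) x -> `|x - x0| < r.
  move=> /closed_cube_dist/(_ (closed_cube_index n x0))/le_lt_trans; apply.
  by rewrite -[r]invrK ltf_pV2 ?posrE ?invr_gt0 ?exprn_gt0//; exact: upper_nthrootP.
set D := 'J f x0 in D0 rf; set K := closed_cube _ _ in near *.
have uD : D \in unitmx by rewrite unitmxE unitfE.
pose h x := f x *m invmx D.
have mh : measurable_fun setT h.
  exact: (measurableT_comp (measurable_mulmx (invmx D)) mf).
have [mD DE] := scales_mulmx D0.
have -> : K `&` f @^-1` A = K `&` h @^-1` ((fun v => v *m D) @^-1` A).
  by congr (_ `&` _); apply/seteqP; split => x /=; rewrite /h mulmxKV.
have mDA : measurable ((fun v => v *m D) @^-1` A).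
  by rewrite -[X in measurable X]setTI; exact: mD.
apply: le_trans (lebesgue_expanding (th := 1 - eta) _ mh _ _ mDA) _.
- exact: measurable_closed_cube.
- by rewrite subr_gt0.
- by move=> x y Kx Ky; apply: rf; exact: near.
rewrite DE// muleA -EFinM /kappa lee_wpmul2r// lee_fin ler_wpM2l//.
  by rewrite invr_ge0 exprn_ge0// subr_ge0 ltW.
have cD : c <= `|\det D| := detc x0.
by rewrite lef_pV2 ?posrE ?(lt_le_trans c0 cD).
Qed.

(** Countably many good cubes cover the source.  Their images are compact, hence
measurable, so the target can be cut into disjoint pieces, each of which lies in
the image of one good cube; by injectivity the preimage of a piece lies in that
cube, and the local inequalities add up. *)
Lemma global_expansion eta A : 0 < eta < 1 -> measurable A ->
  (lebesgue_rV N (f @^-1` A) <= kappa eta * lebesgue_rV N A)%E.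
Proof.
move=> eta01 mA.
have k0 : (0 <= kappa eta)%E.
  move: eta01 => /andP[_ e1].
  by rewrite lee_fin divr_ge0 ?ltW// invr_gt0 exprn_gt0// subr_gt0.
pose K k := if unpickle k is Some (n, z) then
  if pselect (good eta (closed_cube n z)) then closed_cube n z else set0
  else set0.
have goodK k : good eta (K k).
  have good0 : good eta set0.
    by move=> B mB; rewrite set0I measure0; apply: mule_ge0.
  by rewrite /K; case: unpickle => [[n z]|//]; case: pselect.
have cptK k : compact (K k).
  rewrite /K; case: unpickle => [[n z]|]; [case: pselect => [?|?]|];
  by [exact: compact_closed_cube|exact: compact0].
have coverK x : exists k, K k x.
  have [n gn] := local_expansion x eta01.
  exists (pickle (n, dyadic_index n x)); rewrite /K pickleK.
  by case: pselect => [? /=|[]//]; exact: closed_cube_index.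
have mfK k : measurable (f @` K k).
  apply: closed_rV_measurable; apply: compact_closed.
    exact: norm_hausdorff.
  apply: continuous_compact => //; apply: continuous_subspaceT => x.
  exact: differentiable_continuous.
pose F k := A `&` f @` K k.
have mF k : measurable (F k) by exact: measurableI.
have AE : f @^-1` A = \bigcup_k (f @^-1` (seqDU F k)).
  rewrite -preimage_bigcup -seqDU_bigcup_eq; apply/seteqP; split => x.
    by move=> Ax; have [k Kx] := coverK x; exists k => //; split => //; exists x.
  by move=> [k _ []].
have mD k : measurable (seqDU F k).
  by apply: measurableD => //; exact: bigsetU_measurable.
rewrite AE measure_bigcup//; first last.
- move=> i j _ _ [x [xi xj]].
  by apply: (@trivIset_seqDU _ F) => //; exists (f x).
- by move=> k _; exact: measurable_preimage_f.
apply: (@le_trans _ _ (\sum_(k <oo) (kappa eta * lebesgue_rV N (seqDU F k)))%E).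
  rewrite [leLHS](eq_eseriesl (Q := xpredT)); last by move=> k; rewrite in_setT.
  apply: lee_nneseries => [//|k _].
  have -> : f @^-1` seqDU F k = K k `&` f @^-1` seqDU F k.
    apply/seteqP; split => [x|x []//] Fx; split => //.
    by move: Fx => [[_ [y Ky /injf <-]] _].
  exact: goodK.
rewrite nneseriesZl//.
apply: lee_wpmul2l => //.
rewrite -(eq_eseriesl (P := fun k => k \in [set: nat])); last first.
  by move=> k; rewrite in_setT.
rewrite -measure_bigcup; [|by move=> k _; exact: mD|exact: trivIset_seqDU].
apply: le_measure; rewrite ?inE//.
  exact: bigcup_measurable.
by rewrite -seqDU_bigcup_eq => x [k _ []].
Qed.

(** The loss (1 - eta) ^- N of the previous lemma disappears as eta tends to 0. *)
Theorem lebesgue_preimage_le A : measurable A ->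
  (lebesgue_rV N (f @^-1` A) <= c^-1%:E * lebesgue_rV N A)%E.
Proof.
move=> mA.
have [->|Afin] := eqVneq (lebesgue_rV N A) +oo%E.
  by rewrite gt0_muley ?leey// lte_fin invr_gt0.
have ge0 B : (0 <= lebesgue_rV N B)%E by exact: measure_ge0.
have fA : lebesgue_rV N A \is a fin_num by rewrite ge0_fin_numE// ltey.
have ffA : lebesgue_rV N (f @^-1` A) \is a fin_num.
  rewrite ge0_fin_numE//; apply: le_lt_trans (@global_expansion 2^-1 A _ mA) _.
    by rewrite invr_gt0 ltr0n /= invf_lt1 ?ltr1n.
  by rewrite ltey_eq fin_numM.
rewrite -(fineK fA) -(fineK ffA) -EFinM lee_fin.
set a := fine _; set b := fine _.
have a0 : 0 <= a by exact: fine_ge0.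
have b0 : 0 <= b by exact: fine_ge0.
have key eta : 0 < eta < 1 -> (1 - N%:R * eta) * a <= c^-1 * b.
  move=> eta01; have := global_expansion eta01 mA.
  rewrite -(fineK fA) -(fineK ffA) -EFinM lee_fin -/a -/b => ab.
  have t0 : 0 < (1 - eta) ^+ N by rewrite exprn_gt0// subr_gt0; case/andP: eta01.
  have : (1 - eta) ^+ N * a <= c^-1 * b.
    by rewrite -ler_pdivlMl// mulrA.
  apply: le_trans; apply: ler_wpM2r => //.
  (* Bernoulli's inequality *)
  move: eta01 => /andP[e0 e1]; elim: (N) => [|k IH].
    by rewrite mul0r subr0 expr0.
  rewrite exprS; apply: (@le_trans _ _ ((1 - eta) * (1 - k%:R * eta))).
    rewrite -addn1 natrD mulrDl mul1r.
    have : 0 <= k%:R * eta * eta by rewrite !mulr_ge0// ltW.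
    lra.
  by apply: ler_wpM2l => //; rewrite subr_ge0 ltW.
apply/ler_addgt0Pr => e e0.
pose k := N%:R * a + 1; have k0 : 0 < k by rewrite ltr_wpDl// mulr_ge0.
(* small enough that N eta a <= e, and below 1 *)
pose eta := Num.min (e / k) 2^-1.
have eta0 : 0 < eta by rewrite lt_min divr_gt0//= invr_gt0.
have /key : 0 < eta < 1.
  by rewrite eta0 /= gt_min orbC invf_lt1 ?ltr1n.
have : N%:R * eta * a <= e.
  rewrite mulrAC; apply: (@le_trans _ _ (k * (e / k))); last first.
    by rewrite mulrC divfK// gt_eqF.
  apply: ler_pM; [by rewrite mulr_ge0|by rewrite ltW|by rewrite /k lerDl|].
  by rewrite /eta ge_min lexx.
lra.
Qed.

End global.
End volume_expansion.

(** * Trajectories driven by independent noise *)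

Section trajectories.
Context {R : realType} {N : nat}.
Variable f : 'rV[R]_N -> 'rV[R]_N.

Fixpoint trajectory (s : nat -> 'rV[R]_N) (v : 'rV[R]_N) (n : nat) : 'rV[R]_N :=
  if n is n'.+1 then f (trajectory s v n') + s n' else v.

Lemma measurable_trajectory d (T : measurableType d)
    (s : T -> nat -> 'rV[R]_N) (v : T -> 'rV[R]_N) n :
  measurable_fun setT f -> measurable_fun setT v ->
  (forall i, measurable_fun setT (fun t => s t i)) ->
  measurable_fun setT (fun t => trajectory (s t) (v t) n).
Proof.
move=> mf mv ms; elim: n => [//|n IH] /=.
by apply: measurable_addmx => //; exact: (measurableT_comp mf IH).
Qed.

(** One step is f followed by a translation; the former shrinks the measure of
preimages by c and the latter preserves it. *)
Lemma lebesgue_trajectory_le (c : R) s n K : 0 < c ->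
  measurable_fun setT f ->
  (forall A, measurable A ->
     (lebesgue_rV N (f @^-1` A) <= c^-1%:E * lebesgue_rV N A)%E) ->
  measurable K ->
  (lebesgue_rV N [set v | K (trajectory s v n)] <= (c ^- n)%:E * lebesgue_rV N K)%E.
Proof.
move=> c0 mf fle; elim: n K => [|n IH] K mK.
  by rewrite expr0 invr1 mul1e.
have [mt tE] := scales_translation (s n).
have mK' : measurable ((fun v => v + s n) @^-1` K).
  by rewrite -[X in measurable X]setTI; exact: mt.
have mK'' : measurable (f @^-1` ((fun v => v + s n) @^-1` K)).
  by rewrite -[X in measurable X]setTI; exact: mf.
apply: (le_trans (IH _ mK'')).
rewrite exprSr invfM EFinM -muleA; apply: lee_wpmul2l.
  by rewrite lee_fin invr_ge0 exprn_ge0// ltW.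
by apply: (le_trans (fle _ mK')); rewrite tE// mul1e.
Qed.

End trajectories.

Section independence.
Context d {T : measurableType d} {R : realType} (P : probability T R) {N : nat}.
Variables (x0 : T -> 'rV[R]_N) (w : nat -> T -> 'rV[R]_N) (p : 'rV[R]_N -> R).
Hypotheses (mx0 : measurable_fun setT x0)
  (mw : forall n, measurable_fun setT (w n))
  (w_x0 : independent_of_sequence P x0 w) (px0 : has_density P x0 p).

Let Tw := g_sigma_algebraType (sequence_gen w).

Lemma sequence_gen_measurable : <<s sequence_gen w >> `<=` measurable.
Proof.
apply: smallest_sub; first exact: sigma_algebra_measurable.
by move=> _ [n _ [Y mY <-]]; rewrite setTI -[X in measurable X]setTI; exact: mw.
Qed.

Lemma measurable_noise n : measurable_fun [set: Tw] (w n : Tw -> _).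
Proof.
move=> _ Y mY; rewrite setTI; apply: sub_sigma_algebra.
by exists n => //; exists Y => //; rewrite setTI.
Qed.

Let idw : T -> Tw := id.

Let midw : measurable_fun [set: T] idw.
Proof. by move=> _ Y mY; rewrite setTI; exact: sequence_gen_measurable. Qed.

(** By independence the joint law of the noise and x0 is a product, so Fubini
computes the probability of S by averaging those of its sections.  The noise
sequence is represented by the sample point itself, with the sigma-algebra
generated by w. *)
Lemma prob_section_le (S : set (Tw * 'rV[R]_N)) (del : R) : 0 <= del ->
  measurable S ->
  (forall o, (P (x0 @^-1` [set v | S (o, v)]) <= del%:E)%E) ->
  (P [set o | S (o, x0 o)] <= del%:E)%E.
Proof.
move=> del0 mS Sdel.
have mjoint : measurable_fun [set: T] (fun o => (idw o, x0 o)).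
  exact: measurable_fun_pair.
pose mix1 := isMeasurableFun.Build _ _ _ _ _ midw.
pose X1 : {mfun T >-> Tw} := HB.pack idw mix1.
pose mix2 := isMeasurableFun.Build _ _ _ _ _ mx0.
pose X2 : {mfun T >-> 'rV[R]_N} := HB.pack x0 mix2.
have := @product_measure_unique _ _ _ _ R (distribution P X1)
  (distribution P X2) (pushforward_measure P mjoint).
move=> /(_ _ S mS) => jE.
have -> : P [set o | S (o, x0 o)] = pushforward_measure P mjoint S by [].
rewrite -jE; last first.
  move=> A B mA mB; rewrite pushforward_measureE /= /distribution /pushforward /=.
  rewrite muleC -w_x0//; congr (P _); apply/seteqP; split => o /=.
    by move=> [? ?]; split.
  by move=> [? ?]; split.
rewrite /= /product_measure1.
apply: (@le_trans _ _ (\int[distribution P X1]_o (cst del%:E) o)%E).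
  apply: ge0_le_integral => //.
  - exact: measurable_fun_xsection.
  - move=> o _; apply: le_trans (Sdel o).
    have -> // : x0 @^-1` [set v | S (o, v)] = X2 @^-1` xsection S o.
    by apply/seteqP; split => z; rewrite /xsection /= inE.
by rewrite integral_cst//= probability_setT mule1.
Qed.

Lemma density_le (kap : R) A : measurable A -> 0 <= kap ->
  (P (x0 @^-1` (A `&` [set v | (p v <= kap)%R])) <= kap%:E * lebesgue_rV N A)%E.
Proof.
move=> mA kap0; have [mp p0 pE] := px0.
have mG : measurable [set v | p v <= kap].
  have -> : [set v | p v <= kap] = p @^-1` `]-oo, kap].
    by apply/seteqP; split => v /=; rewrite in_itv.
  by rewrite -[X in measurable X]setTI; exact: mp.
have mAG := measurableI _ _ mA mG.
rewrite pE//; apply: (@le_trans _ _ (\int[lebesgue_rV N]_(v in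
    A `&` [set v | (p v <= kap)%R]) (cst kap%:E) v)%E).
  apply: ge0_le_integral => //.
  - by move=> v _; rewrite lee_fin.
  - by apply/measurable_EFinP; exact: measurable_funS mp.
  - by move=> v [_ /=]; rewrite lee_fin.
rewrite integral_cst//; apply: lee_wpmul2l; first by rewrite lee_fin.
by apply: le_measure; rewrite ?inE//; exact: subIsetl.
Qed.

(** For a frozen noise sequence the admissible initial points form a set of measure
at most c ^- n vol(K), on which the density is at most kap. *)
Lemma prob_trajectory_le (f : 'rV[R]_N -> 'rV[R]_N) (c kap del : R)
    (a : nat -> 'rV[R]_N) n K :
  0 < c -> 0 <= kap -> measurable_fun setT f ->
  (forall A, measurable A ->
     (lebesgue_rV N (f @^-1` A) <= c^-1%:E * lebesgue_rV N A)%E) ->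
  measurable K -> (kap%:E * ((c ^- n)%:E * lebesgue_rV N K) <= del%:E)%E ->
  (P [set o | K (trajectory f (fun t => (a t + w t o)%R) (x0 o) n) /\
     (p (x0 o) <= kap)%R] <= del%:E)%E.
Proof.
move=> c0 kap0 mf fle mK Kdel; have [mp p0 _] := px0.
pose S : set (Tw * 'rV[R]_N) :=
  [set ov | K (trajectory f (fun t => a t + w t ov.1) ov.2 n) /\ p ov.2 <= kap].
have mtraj : measurable_fun [set: Tw * 'rV[R]_N]
    (fun ov => trajectory f (fun t => a t + w t ov.1) ov.2 n).
  apply: (measurable_trajectory n mf measurable_snd) => i.
  apply: measurable_addmx; first exact: measurable_cst.
  exact: (measurableT_comp (measurable_noise i) measurable_fst).
have mS : measurable S.
  apply: measurableI.
    by rewrite -[X in measurable X]setTI; exact: mtraj.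
  have mp2 := measurableT_comp mp (@measurable_snd _ _ Tw 'rV[R]_N).
  have := mp2 measurableT _ (@measurable_itv R `]-oo, kap]); rewrite setTI.
  by congr measurable; apply/seteqP; split => v /=; rewrite in_itv.
have del0 : 0 <= del.
  rewrite -lee_fin; apply: le_trans Kdel; rewrite !mule_ge0// lee_fin//.
  by rewrite invr_ge0 exprn_ge0// ltW.
apply: (@prob_section_le S del del0 mS) => o.
pose A := [set v | K (trajectory f (fun t => a t + w t o) v n)].
have mA : measurable A.
  rewrite -[X in measurable X]setTI.
  have mt : measurable_fun [set: 'rV[R]_N]
      (fun v => trajectory f (fun t => a t + w t o) v n).
    by apply: measurable_trajectory => // i; exact: measurable_cst.
  exact: mt.
apply: le_trans (density_le mA kap0) (le_trans _ Kdel).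
apply: lee_wpmul2l; first by rewrite lee_fin.
exact: lebesgue_trajectory_le.
Qed.

End independence.

(** * Directed information of a finite joint law *)

Section information.
Context {R : realType}.

(** Sums over the values of random variables become sums over the sample space,
where the logarithms of different conditional mutual informations can be added
pointwise. *)
Lemma sum_pmf_pr (S A : finType) (p : S -> R) (X : S -> A) (phi : A -> R) :
  \sum_(a : A) pmf_pr p (fun s => X s == a) * phi a = \sum_s p s * phi (X s).
Proof.
rewrite [RHS](partition_big X xpredT)//=; apply: eq_bigr => a _.
rewrite /pmf_pr mulr_suml; apply: eq_bigr => s /eqP <-; by [].
Qed.

Lemma mutual_infoE (S A B : finType) (p : S -> R) (X : S -> A) (Y : S -> B) :
  mutual_info p X Y = \sum_s p s *
    log2 (pmf_pr p (fun s' => (X s' == X s) && (Y s' == Y s)) /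
      (pmf_pr p (fun s' => X s' == X s) * pmf_pr p (fun s' => Y s' == Y s))).
Proof.
rewrite /mutual_info pair_big /=.
have := @sum_pmf_pr S (A * B)%type p (fun s => (X s, Y s)) (fun ab =>
  log2 (pmf_pr p (fun s' => (X s' == ab.1) && (Y s' == ab.2)) /
      (pmf_pr p (fun s' => X s' == ab.1) * pmf_pr p (fun s' => Y s' == ab.2)))).
move=> /= <-; apply: eq_bigr => -[a b] _ /=.
by congr (_ * _); apply: eq_bigl => s; rewrite xpair_eqE.
Qed.

Lemma cond_mutual_infoE (S A B D : finType) (p : S -> R)
    (X : S -> A) (Y : S -> B) (Z : S -> D) :
  cond_mutual_info p X Y Z = \sum_s p s *
    log2 ((pmf_pr p (fun s' => [&& X s' == X s, Y s' == Y s & Z s' == Z s]) *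
        pmf_pr p (fun s' => Z s' == Z s)) /
      (pmf_pr p (fun s' => (X s' == X s) && (Z s' == Z s)) *
        pmf_pr p (fun s' => (Y s' == Y s) && (Z s' == Z s)))).
Proof.
rewrite /cond_mutual_info pair_big /= pair_big /=.
have := @sum_pmf_pr S (A * B * D)%type p (fun s => (X s, Y s, Z s)) (fun abc =>
    log2 ((pmf_pr p (fun s' =>
          [&& X s' == abc.1.1, Y s' == abc.1.2 & Z s' == abc.2]) *
        pmf_pr p (fun s' => Z s' == abc.2)) /
      (pmf_pr p (fun s' => (X s' == abc.1.1) && (Z s' == abc.2)) *
        pmf_pr p (fun s' => (Y s' == abc.1.2) && (Z s' == abc.2))))).
move=> /= <-; apply: eq_bigr => -[[a b] c] _ /=.
by congr (_ * _); apply: eq_bigl => s; rewrite !xpair_eqE andbA.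
Qed.

Lemma log2M (x y : R) : 0 < x -> 0 < y -> log2 (x * y) = log2 x + log2 y.
Proof. by move=> x0 y0; rewrite /log2 lnM// mulrDl. Qed.

Lemma log2V (x : R) : 0 < x -> log2 x^-1 = - log2 x.
Proof. by move=> x0; rewrite /log2 lnV// mulNr. Qed.

Lemma log2_prod n (F : 'I_n -> R) : (forall i, 0 < F i) ->
  log2 (\prod_i F i) = \sum_i log2 (F i).
Proof.
elim: n F => [|n IH] F F0; first by rewrite !big_ord0 /log2 ln1 mul0r.
rewrite !big_ord_recl log2M// ?IH// prodr_gt0//.
Qed.

Context {M M' : finType} {n : nat}.
Local Notation S := (n.+1.-tuple M * n.+1.-tuple M')%type.

Definition prefix_pr (p : S -> R) i j (s : S) : R :=
  pmf_pr p (fun s' => (take i s'.1 == take i s.1) && (take j s'.2 == take j s.2)).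

Lemma tnth_take1 (U : eqType) m (a b : m.+1.-tuple U) :
  (tnth a ord0 == tnth b ord0) = (take 1 a == take 1 b).
Proof.
case/tupleP: a => x a; case/tupleP: b => y b.
by rewrite /= !take0 eqseq_cons andbT.
Qed.

Lemma tnth_takeS (U : eqType) m (a b : m.-tuple U) (t : 'I_m) :
  (tnth a t == tnth b t) && (take t a == take t b) =
  (take t.+1 a == take t.+1 b).
Proof.
have x0 := tnth a t.
rewrite !(take_nth x0) ?size_tuple// eqseq_rcons -!(tnth_nth x0) andbC.
by [].
Qed.

(** When Qf t is the conditional probability of output t given the past, the t-th
conditional mutual information is the mean of
log2 (Qf t r_t / r_(t+1)), with r_t the probability of the first t outputs.
The r_t telescope, and r_0 = 1. *)
Lemma directed_infoE (p : S -> R) (Qf : 'I_n.+1 -> S -> R) :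
  (forall s, 0 <= p s) -> \sum_s p s = 1 ->
  (forall (t : 'I_n.+1) s,
     prefix_pr p t.+1 t.+1 s = Qf t s * prefix_pr p t.+1 t s) ->
  directed_info p =
    \sum_s p s * log2 (\prod_t Qf t s / pmf_pr p (fun s' => s'.2 == s.2)).
Proof.
move=> p0 p1 QfE.
have pre_ge0 i j s : 0 <= prefix_pr p i j s by apply: sumr_ge0.
have pre_gt0 i j s : 0 < p s -> 0 < prefix_pr p i j s.
  move=> ps; rewrite /prefix_pr /pmf_pr (bigD1 s)/= ?eqxx//.
  by rewrite ltr_pwDl// sumr_ge0.
have Qf_gt0 (t : 'I_n.+1) s : 0 < p s -> 0 < Qf t s.
  move=> ps; have := pre_gt0 t.+1 t.+1 s ps; rewrite QfE.
  by rewrite pmulr_lgt0// pre_gt0.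
pose term (t : nat) (s : S) :=
  log2 (prefix_pr p 0 t s) - log2 (prefix_pr p 0 t.+1 s).
have pre00 s : prefix_pr p 0 0 s = 1.
  rewrite /prefix_pr /pmf_pr -[RHS]p1; apply: eq_bigl => s'.
  by rewrite !take0 !eqxx.
have -> : directed_info p = \sum_(t < n.+1) \sum_s p s * (log2 (Qf t s) + term t s).
  rewrite /directed_info [RHS](bigD1 ord0)//= [LHS]addrC; congr (_ + _).
    rewrite mutual_infoE; apply: eq_bigr => s _.
    have [->|ps] := eqVneq (p s) 0; first by rewrite !mul0r.
    have {}ps : 0 < p s by rewrite lt_neqAle eq_sym ps p0.
    rewrite [pmf_pr p _](_ : _ = prefix_pr p 1 1 s); last first.
      by apply: eq_bigl => s'; rewrite !tnth_take1.
    rewrite [X in _ / (X * _)](_ : _ = prefix_pr p 1 0 s); last first.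
      by apply: eq_bigl => s'; rewrite tnth_take1 !take0 eqxx andbT.
    rewrite [X in _ / (_ * X)](_ : _ = prefix_pr p 0 1 s); last first.
      by apply: eq_bigl => s'; rewrite tnth_take1 !take0 eqxx.
    congr (_ * _); have := QfE ord0 s; rewrite /= => ->.
    rewrite invfM mulrA mulfK; last by rewrite gt_eqF ?pre_gt0.
    rewrite log2M ?log2V ?invr_gt0 ?pre_gt0// ?Qf_gt0//.
    by rewrite /term pre00 /log2 ln1 mul0r add0r.
  apply: eq_big => [t|t t0]; first by rewrite lt0n -(inj_eq val_inj).
  rewrite cond_mutual_infoE; apply: eq_bigr => s _.
  have [->|ps] := eqVneq (p s) 0; first by rewrite !mul0r.
  have {}ps : 0 < p s by rewrite lt_neqAle eq_sym ps p0.
  rewrite [pmf_pr p _](_ : _ = prefix_pr p t.+1 t.+1 s); last first.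
    by apply: eq_bigl => s'; rewrite -!val_eqE /= tnth_takeS.
  rewrite [X in _ * X / _](_ : _ = prefix_pr p 0 t s); last first.
    by apply: eq_bigl => s'; rewrite -!val_eqE /= !take0 eqxx.
  rewrite [X in _ / (X * _)](_ : _ = prefix_pr p t.+1 t s); last first.
    by apply: eq_bigl => s'; rewrite -!val_eqE /=.
  rewrite [X in _ / (_ * X)](_ : _ = prefix_pr p 0 t.+1 s); last first.
    by apply: eq_bigl => s'; rewrite -!val_eqE /= tnth_takeS !take0 eqxx.
  congr (_ * _); rewrite QfE.
  have -> : Qf t s * prefix_pr p t.+1 t s * prefix_pr p 0 t s /
     (prefix_pr p t.+1 t s * prefix_pr p 0 t.+1 s) =
     Qf t s * (prefix_pr p 0 t s * (prefix_pr p 0 t.+1 s)^-1).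
    by field; rewrite !gt_eqF ?pre_gt0.
  rewrite log2M ?mulr_gt0 ?invr_gt0 ?pre_gt0 ?Qf_gt0//.
  by rewrite log2M ?invr_gt0 ?pre_gt0// log2V ?pre_gt0.
rewrite exchange_big /=; apply: eq_bigr => s _; rewrite -mulr_sumr.
have [->|ps] := eqVneq (p s) 0; first by rewrite !mul0r.
have {}ps : 0 < p s by rewrite lt_neqAle eq_sym ps p0.
congr (_ * _); rewrite big_split /=.
have -> : \sum_(t < n.+1) term t s = - log2 (prefix_pr p 0 n.+1 s).
  elim: (n.+1) => [|t IH]; first by rewrite big_ord0 pre00 /log2 ln1 mul0r oppr0.
  by rewrite big_ord_recr /= IH /term; ring.
rewrite (_ : prefix_pr p 0 n.+1 s = pmf_pr p (fun s' => s'.2 == s.2)); last first.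
  apply: eq_bigl => s'; rewrite !take0 eqxx /= -val_eqE /=.
  by rewrite !take_oversize ?size_tuple.
have r0 : 0 < pmf_pr p (fun s' => s'.2 == s.2).
  by rewrite /pmf_pr (bigD1 s)/= ?eqxx// ltr_pwDl// sumr_ge0.
rewrite log2M ?invr_gt0// ?prodr_gt0// => [|i _]; last exact: Qf_gt0.
by rewrite log2V// log2_prod// => i; exact: Qf_gt0.
Qed.

End information.

(** Think of e as the part of p on some event; dividing by W turns p into a
sub-probability under which this event weighs at most del.  Integrate the bound
ln W >= ln g - g / W + 1, a form of ln y <= y - 1, against p, with
g = 1 / del on the event and g = 1 off it. *)
Lemma gibbs_event {R : realType} (S : finType) (p e W : S -> R) (del : R) :
  (forall s, 0 <= e s <= p s) -> (forall s, 0 <= W s) ->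
  (forall s, 0 < p s -> 0 < W s) ->
  \sum_s p s = 1 -> 0 < del ->
  \sum_s e s / W s <= del -> \sum_s p s / W s <= 1 ->
  (\sum_s e s) * ln del^-1 - 1 <= \sum_s p s * ln (W s).
Proof.
move=> ep W0 Wp p1 del0 eW pW.
have ln_le (x y : R) : 0 < x -> 0 < y -> ln x - x / y + 1 <= ln y.
  move=> x0 y0; have : ln (x / y) <= x / y - 1.
    rewrite [in leLHS](_ : x / y = 1 + (x / y - 1)); last by ring.
    by apply: le_ln1Dx; rewrite ltrBrDl subrr divr_gt0.
  by rewrite ln_div//; lra.
have key s : e s * ln del^-1 - del^-1 * (e s / W s) + p s - p s / W s + 0 <=
    p s * ln (W s).
  have /andP[e0 eps] := ep s.
  have [ps0|ps0] := eqVneq (p s) 0.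
    have -> : e s = 0 by apply/eqP; rewrite eq_le e0 -ps0 eps.
    by rewrite ps0 !mul0r mulr0; lra.
  have ps : 0 < p s by rewrite lt_neqAle eq_sym ps0 (le_trans e0).
  have Ws := Wp s ps.
  have d0 : 0 < del^-1 by rewrite invr_gt0.
  have h1 := ler_wpM2l e0 (ln_le del^-1 (W s) d0 Ws).
  have h2 := ln_le 1 (W s) ltr01 Ws; rewrite ln1 in h2.
  have {}h2 : (p s - e s) * (0 - 1 / W s + 1) <= (p s - e s) * ln (W s).
    by apply: ler_wpM2l h2; rewrite subr_ge0.
  have : 0 <= e s / W s by rewrite divr_ge0.
  lra.
have := @ler_sum _ _ (index_enum S) xpredT _ _ (fun s _ => key s).
rewrite big_split /= big1_eq addr0 sumrB big_split /= sumrB p1.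
rewrite -mulr_suml -mulr_sumr.
have : del^-1 * (\sum_s e s / W s) <= 1 by rewrite mulrC ler_pdivrMr// mul1r.
lra.
Qed.

(** * The closed loop over the channel *)

Section finite_partition.
Context d {T : measurableType d} {R : realType} (P : probability T R).

Definition Pr (A : set T) : R := fine (P A).

Lemma PrK A : measurable A -> (Pr A)%:E = P A.
Proof. by move=> mA; rewrite /Pr fineK// fin_num_measure. Qed.

Lemma Pr_ge0 A : 0 <= Pr A.
Proof. by rewrite /Pr fine_ge0. Qed.

Lemma Pr_le A B : measurable A -> measurable B -> A `<=` B -> Pr A <= Pr B.
Proof.
by move=> mA mB AB; rewrite -lee_fin !PrK//; apply: le_measure; rewrite ?inE.
Qed.

Lemma PrT : Pr setT = 1.
Proof. by rewrite /Pr probability_setT. Qed.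

Lemma Pr_partition (S : finType) (Z : T -> S) (E : pred S) (A : set T) :
  (forall z, measurable [set o | Z o = z]) -> measurable A ->
  Pr ([set o | E (Z o)] `&` A) = \sum_(z | E z) Pr ([set o | Z o = z] `&` A).
Proof.
move=> mZ mA; have mZA z : measurable ([set o | Z o = z] `&` A).
  exact: measurableI.
apply: EFin_inj; pose r := [seq z <- enum S | E z].
have -> : [set o | E (Z o)] `&` A =
    \bigcup_(z in [set` r]) ([set o | Z o = z] `&` A).
  apply/seteqP; split => o /=.
    by move=> [Eo Ao]; exists (Z o) => //; rewrite /= mem_filter Eo mem_enum.
  by move=> [z /=]; rewrite mem_filter => /andP[Ez _] [-> Ao].
rewrite PrK; last by apply: fin_bigcup_measurable => // z _; exact: mZA.
rewrite measure_fin_bigcup//; last first.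
  by move=> i j _ _ [s [[/= <- _] [/= <- _]]].
rewrite -fsbig_seq; last by rewrite filter_uniq ?enum_uniq.
rewrite /r big_filter big_enum_cond.
rewrite -sumEFin; apply: eq_bigr => z _; exact/esym/PrK.
Qed.

Lemma Pr_partitionT (S : finType) (Z : T -> S) (A : set T) :
  (forall z, measurable [set o | Z o = z]) -> measurable A ->
  Pr A = \sum_z Pr ([set o | Z o = z] `&` A).
Proof.
move=> mZ mA; rewrite -Pr_partition//; congr Pr.
by apply/seteqP; split => // o [].
Qed.

Lemma Pr_setI_ge (A B : set T) : measurable A -> measurable B ->
  Pr A + Pr B - 1 <= Pr (A `&` B).
Proof.
move=> mA mB; pose Z t := `[< B t >].
have Zt : [set t | Z t = true] = B by apply/seteqP; split => t /= /asboolP.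
have Zf : [set t | Z t = false] = ~` B.
  by apply/seteqP; split => t; rewrite /= /Z; case: asboolP.
have mZ z : measurable [set t | Z t = z].
  by case: z; [rewrite Zt|rewrite Zf; exact: measurableC].
have := Pr_partitionT mZ mA; have := Pr_partitionT mZ (@measurableT _ T).
rewrite !big_bool /= Zt Zf !setIT PrT [B `&` A]setIC => h1 h2.
have : Pr (~` B `&` A) <= Pr (~` B).
  have mBc := measurableC mB.
  by apply: Pr_le; [exact: measurableI|exact: mBc|exact: subIsetl].
lra.
Qed.

End finite_partition.

Lemma eq_mktupleP (A : Type) (y0 : A) (X : nat -> A) n (z : n.-tuple A) :
  [tuple X i | i < n] = z <-> forall i, (i < n)%N -> X i = nth y0 z i.
Proof.
split=> [<- i ni|Xz].
  by rewrite -(tnth_nth y0 [tuple X i | i < n] (Ordinal ni)) tnth_mktuple.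
by apply: eq_from_tnth => i; rewrite tnth_mktuple Xz// -tnth_nth.
Qed.

Lemma take_mktupleP (A : eqType) (y0 : A) (X : nat -> A) n m (z : n.-tuple A) :
  (m <= n)%N -> reflect (forall i, (i < m)%N -> X i = nth y0 z i)
    (take m [tuple X i | i < n] == take m z).
Proof.
move=> mn; have nX i : (i < n)%N -> nth y0 [tuple X i | i < n] i = X i.
  by move=> ni; rewrite -(tnth_nth y0 _ (Ordinal ni)) tnth_mktuple.
apply: (iffP eqP) => [h i im|h].
  by rewrite -(nth_take y0 im z) -h nth_take// nX// (leq_trans im).
apply: (@eq_from_nth _ y0); first by rewrite !size_takel ?size_tuple.
move=> i; rewrite size_takel ?size_tuple// => im.
by rewrite !nth_take// nX ?h// (leq_trans im).
Qed.

Lemma take_mkseq_nth (A : Type) (y0 : A) n (z : n.-tuple A) t : (t <= n)%N ->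
  take t z = mkseq (nth y0 z) t.
Proof.
move=> tn; apply: (@eq_from_nth _ y0).
  by rewrite size_takel ?size_mkseq ?size_tuple.
move=> i; rewrite size_takel ?size_tuple// => it.
by rewrite nth_take// nth_mkseq.
Qed.

Section closed_loop.
Context d {T : measurableType d} {R : realType} (P : probability T R)
  {N k : nat} {M M' : finType}.
Variables (f : 'rV[R]_N -> 'rV[R]_N) (B : 'M[R]_(N, k))
  (Q : seq M -> seq M' -> M' -> R)
  (x w : nat -> T -> 'rV[R]_N) (u : nat -> T -> 'rV[R]_k)
  (q : nat -> T -> M) (q' : nat -> T -> M')
  (ge : forall t : nat, t.+1.-tuple 'rV[R]_N -> t.-tuple M' -> M)
  (g : forall t : nat, t.+1.-tuple M' -> 'rV[R]_k)
  (a0 : M) (b0 : M').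
Implicit Types (a : nat -> M) (b : nat -> M') (t n : nat) (F : set T).

Definition exogenous : set (set T) :=
  <<s preimage_set_system [set: T] (x 0%N) measurable `|` sequence_gen w >>.

Hypotheses (mf : measurable_fun [set: 'rV[R]_N] f)
  (mx0 : measurable_fun [set: T] (x 0%N))
  (mw : forall n, measurable_fun [set: T] (w n))
  (mq' : forall t, finite_rv (q' t))
  (sys : controlled_system f B x u w)
  (mge : forall t y, finite_rv (fun z => @ge t z y))
  (qE : forall t o, q t o = @ge t [tuple x i o | i < t.+1] [tuple q' i o | i < t])
  (uE : forall t o, u t o = @g t [tuple q' i o | i < t.+1])
  (Qcond : forall t (A : {set M'}), is_cond_prob P
     <<s channel_history q q' t
         `|` preimage_set_system [set: T] (x 0%N) measurable
         `|` sequence_gen w >>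
     [set o | q' t o \in A]
     (fun o => \sum_(b in A) Q (history q t.+1 o) (history q' t o) b)).

(** The loop run open: the encoder and the controller are fed the fixed outputs b
instead of those of the channel, so that states and inputs become functions of
(x_0, w). *)
Definition open_control b t : 'rV[R]_N := @g t [tuple b i | i < t.+1] *m B^T.

Definition open_state b t o :=
  trajectory f (fun i => open_control b i + w i o) (x 0%N o) t.

Definition open_input b t o : M :=
  @ge t [tuple open_state b i o | i < t.+1] [tuple b i | i < t].

Lemma open_stateE b n o : (forall i, (i < n)%N -> q' i o = b i) ->
  forall t, (t <= n)%N -> x t o = open_state b t o.
Proof.
move=> q'b; elim=> [//|t IH] tn.
rewrite sys IH ?(ltnW tn)// /open_state /= -addrA; congr (_ + (_ *m _ + _)).
rewrite uE; congr g; apply: eq_from_tnth => i; rewrite !tnth_mktuple.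
by apply: q'b; apply: leq_ltn_trans tn; rewrite -ltnS.
Qed.

Lemma open_inputE b n o : (forall i, (i < n)%N -> q' i o = b i) ->
  forall t, (t <= n)%N -> q t o = open_input b t o.
Proof.
move=> q'b t tn; rewrite qE; congr ge; apply: eq_from_tnth => i;
  rewrite !tnth_mktuple.
  by apply: (open_stateE q'b); apply: leq_trans tn; rewrite -ltnS.
by apply: q'b; apply: leq_trans tn.
Qed.

Let Tx := g_sigma_algebraType
  (preimage_set_system [set: T] (x 0%N) measurable `|` sequence_gen w).

Lemma measurable_open_state b t :
  measurable_fun [set: Tx] (open_state b t : Tx -> 'rV[R]_N).
Proof.
apply: (@measurable_trajectory R N f _ Tx
  (fun o i => open_control b i + w i o) (x 0%N) t mf).
  by move=> _ Y mY; rewrite setTI; apply: sub_sigma_algebra; left;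
    exists Y => //; rewrite setTI.
move=> i; apply: measurable_addmx; first exact: measurable_cst.
move=> _ Y mY; rewrite setTI; apply: sub_sigma_algebra; right.
by exists i => //; exists Y => //; rewrite setTI.
Qed.

Lemma exogenous_open_input b t c : exogenous [set o | open_input b t o = c].
Proof.
have mz : measurable_fun [set: Tx]
    (fun o => [tuple open_state b i o | i < t.+1] : t.+1.-tuple 'rV[R]_N).
  apply/measurable_fun_tnthP => i.
  rewrite (_ : _ \o _ = open_state b i); first exact: measurable_open_state.
  by apply/funext => o /=; rewrite tnth_mktuple.
have := mz measurableT _ (@mge t [tuple b i | i < t] [set c]).
by rewrite setTI.
Qed.

Lemma exogenous_measurable : exogenous `<=` measurable.
Proof.
apply: smallest_sub; first exact: sigma_algebra_measurable.
move=> Y [[Z mZ <-]|[n _ [Z mZ <-]]]; rewrite setTI -[X in measurable X]setTI.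
  exact: mx0.
exact: mw.
Qed.

Lemma exogenousI F F' : exogenous F -> exogenous F' -> exogenous (F `&` F').
Proof. exact: (@measurableI _ Tx). Qed.

Lemma exogenousT : exogenous setT.
Proof. exact: (@measurableT _ Tx). Qed.

Definition outputs n b : set T := [set o | forall i, (i < n)%N -> q' i o = b i].
Definition open_inputs n a b : set T :=
  [set o | forall i, (i < n)%N -> open_input b i o = a i].
Definition channel_use n a b : set T :=
  [set o | forall i, (i < n)%N -> q i o = a i /\ q' i o = b i].

(** On the event that the outputs are b, the closed loop and the loop run open
against b agree. *)
Lemma channel_useE n a b : channel_use n a b = outputs n b `&` open_inputs n a b.
Proof.
apply/seteqP; split => o.
  move=> qq'; have q'b i : (i < n)%N -> q' i o = b i by move=> /qq'[].
  split; first exact: q'b.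
  by move=> i ni; rewrite -(open_inputE q'b (ltnW ni)); exact: (qq' i ni).1.
move=> [q'b ab] i ni; split; last exact: q'b.
by rewrite (open_inputE q'b (ltnW ni)); exact: ab.
Qed.

Lemma open_inputsS n a b :
  open_inputs n.+1 a b = open_inputs n a b `&` [set o | open_input b n o = a n].
Proof.
apply/seteqP; split => o /=.
  by move=> h; split; [move=> i /ltnW/h|exact: h].
move=> [h hn] i; rewrite ltnS leq_eqVlt => /orP[/eqP->//|]; exact: h.
Qed.

Lemma exogenous_open_inputs n a b : exogenous (open_inputs n a b).
Proof.
elim: n => [|n IH].
  rewrite (_ : open_inputs _ _ _ = setT); first exact: exogenousT.
  by apply/seteqP; split.
by rewrite open_inputsS; apply: exogenousI => //; exact: exogenous_open_input.
Qed.

Lemma measurable_outputs n b : measurable (outputs n b).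
Proof.
rewrite (_ : outputs n b = \bigcap_(i in `I_n) (q' i @^-1` [set b i])).
  by apply: fin_bigcap_measurable => // i _; exact: mq'.
by apply/seteqP; split.
Qed.

Lemma measurable_channel_use n a b : measurable (channel_use n a b).
Proof.
rewrite channel_useE; apply: measurableI; first exact: measurable_outputs.
by apply: exogenous_measurable; exact: exogenous_open_inputs.
Qed.

Lemma channel_use_input n a b c :
  channel_use n a b `&` [set o | q n o = c] =
  channel_use n a b `&` [set o | open_input b n o = c].
Proof.
apply/seteqP; split => o [qq' /= <-]; split => //=;
  have q'b : forall i, (i < n)%N -> q' i o = b i by move=> i /qq'[].
  by rewrite -(open_inputE q'b (leqnn n)).
by rewrite (open_inputE q'b (leqnn n)).
Qed.

(** By the class A property the kernel Q is a conditional law of q'_n also given the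
exogenous variables, and it is constant on the event that the past is (a, b). *)
Lemma Pr_channel_step n a b F : exogenous F ->
  Pr P (channel_use n.+1 a b `&` F) =
  Q (mkseq a n.+1) (mkseq b n) (b n) *
    Pr P (channel_use n a b `&` [set o | q n o = a n] `&` F).
Proof.
move=> xF; have mF := exogenous_measurable xF.
set E := _ `&` [set o | q n o = a n] `&` F.
have mE : measurable E.
  rewrite /E channel_use_input; apply: measurableI => //.
  apply: measurableI; first exact: measurable_channel_use.
  by apply: exogenous_measurable; exact: exogenous_open_input.
have hE o : (channel_use n a b `&` [set o | q n o = a n]) o <->
    (history q n.+1 o = mkseq a n.+1 /\ history q' n o = mkseq b n).
  split.
    move=> [qq' /= qn]; split.
      apply: (@eq_from_nth _ a0); rewrite ?size_mkseq// => i ni.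
      rewrite !nth_mkseq//; move: ni; rewrite ltnS leq_eqVlt => /orP[/eqP->//|].
      by move=> /qq'[].
    apply: (@eq_from_nth _ b0); rewrite ?size_mkseq// => i ni.
    by rewrite !nth_mkseq//; case: (qq' i ni).
  move=> [hq hq'].
  have qi i : (i < n.+1)%N -> q i o = a i.
    by move=> ni; have := congr1 (nth a0 ^~ i) hq; rewrite !nth_mkseq.
  split; last exact: qi.
  move=> i ni; split; first by apply: qi; exact: ltnW.
  by have := congr1 (nth b0 ^~ i) hq'; rewrite !nth_mkseq.
have [_ /(_ E)] := Qcond n [set b n].
have GE : <<s channel_history q q' n
         `|` preimage_set_system [set: T] (x 0%N) measurable
         `|` sequence_gen w >> E.
  apply: (@measurableI _ (g_sigma_algebraType _)).
    apply: sub_sigma_algebra; left; left.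
    exists [set (mkseq a n.+1, mkseq b n)] => //.
    rewrite setTI; apply/seteqP; split => o.
      move=> h; apply: (hE o).2; split; first exact: (congr1 fst h).
      exact: (congr1 snd h).
    by move=> h; have [h1 h2] := (hE o).1 h; congr pair.
  move: F xF {mF E mE}; apply: smallest_sub.
    exact: smallest_sigma_algebra.
  move=> Y xY; apply: sub_sigma_algebra; case: xY => ?; last by right.
  by left; right.
move=> /(_ GE).
have -> : [set o | q' n o \in [set b n]%SET] `&` E = channel_use n.+1 a b `&` F.
  apply/seteqP; split => o /=.
    rewrite inE => -[/eqP q'n [[qq' qn] Fo]]; split => // i.
    by rewrite ltnS leq_eqVlt => /orP[/eqP->//|]; exact: qq'.
  move=> [qq' Fo]; rewrite inE; split; first by case: (qq' n (ltnSn n)) => _ ->.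
  split => //; split; last by case: (qq' n (ltnSn n)).
  by move=> i /ltnW/qq'.
move=> PE; apply: EFin_inj.
rewrite EFinM !PrK//; last first.
  by apply: measurableI => //; exact: measurable_channel_use.
rewrite PE (eq_integral (cst (Q (mkseq a n.+1) (mkseq b n) (b n))%:E)) => [|o].
  by rewrite integral_cst.
by rewrite inE => -[h _]; have [-> ->] := (hE o).1 h; rewrite big_set1.
Qed.

(** One kernel is split off at a time.  The condition on input n is replaced by the
exogenous condition on the input of the open loop, and is absorbed into F. *)
Lemma Pr_channel_use n a b F : exogenous F ->
  Pr P (channel_use n a b `&` F) =
  \prod_(t < n) Q (mkseq a t.+1) (mkseq b t) (b t) *
    Pr P (open_inputs n a b `&` F).
Proof.
elim: n F => [|n IH] F xF.
  rewrite big_ord0 mul1r; congr (Pr _ (_ `&` _)).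
  by apply/seteqP; split.
rewrite Pr_channel_step// channel_use_input -setIA IH; last first.
  by apply: exogenousI => //; exact: exogenous_open_input.
rewrite big_ord_recr /= open_inputsS -setIA; ring.
Qed.

Definition channel_record n o : n.-tuple M * n.-tuple M' :=
  ([tuple q i o | i < n], [tuple q' i o | i < n]).

Lemma channel_recordE n (z : n.-tuple M * n.-tuple M') :
  [set o | channel_record n o = z] = channel_use n (nth a0 z.1) (nth b0 z.2).
Proof.
case: z => za zb; apply/seteqP; split => o.
  move=> h i ni; split.
    exact: ((eq_mktupleP a0 (fun i => q i o) za).1 (congr1 fst h)).
  exact: ((eq_mktupleP b0 (fun i => q' i o) zb).1 (congr1 snd h)).
move=> h; congr pair.
  by apply: (eq_mktupleP a0 (fun i => q i o) za).2 => i ni; case: (h i ni).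
by apply: (eq_mktupleP b0 (fun i => q' i o) zb).2 => i ni; case: (h i ni).
Qed.

Lemma channel_record_prefixP n i j o (s : n.-tuple M * n.-tuple M') :
  (i <= n)%N -> (j <= n)%N ->
  (take i (channel_record n o).1 == take i s.1) &&
  (take j (channel_record n o).2 == take j s.2) <->
  (forall l, (l < i)%N -> q l o = nth a0 s.1 l) /\
  (forall l, (l < j)%N -> q' l o = nth b0 s.2 l).
Proof.
move=> ni nj; split.
  move=> /andP[h1 h2]; split.
    exact: (elimT (take_mktupleP a0 (fun l => q l o) s.1 ni) h1).
  exact: (elimT (take_mktupleP b0 (fun l => q' l o) s.2 nj) h2).
move=> [h1 h2]; apply/andP; split.
  exact: (introT (take_mktupleP a0 (fun l => q l o) s.1 ni) h1).
exact: (introT (take_mktupleP b0 (fun l => q' l o) s.2 nj) h2).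
Qed.

Lemma measurable_channel_record n z : measurable [set o | channel_record n o = z].
Proof. by rewrite channel_recordE; exact: measurable_channel_use. Qed.

Lemma measurable_input n c : measurable [set o | q n o = c].
Proof.
rewrite (_ : [set o | _] = \bigcup_(z in [set: n.-tuple M * n.-tuple M'])
   ([set o | channel_record n o = z] `&`
    [set o | open_input (nth b0 z.2) n o = c])).
  apply: fin_bigcup_measurable => // z _; apply: measurableI.
    exact: measurable_channel_record.
  by apply: exogenous_measurable; exact: exogenous_open_input.
apply/seteqP; split => o /=.
  move=> qc; exists (channel_record n o) => //; split => //=.
  rewrite -qc; apply/esym; apply: open_inputE (leqnn n) => i ni.
  exact: ((eq_mktupleP b0 (fun i => q' i o) _).1 erefl).
move=> [z _ [h <-]]; apply: open_inputE (leqnn n) => i ni.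
exact: ((eq_mktupleP b0 (fun i => q' i o) _).1 (congr1 snd h)).
Qed.

Lemma measurable_state n : measurable_fun [set: T] (x n).
Proof.
move=> _ Y mY; rewrite setTI.
rewrite (_ : _ @^-1` _ = \bigcup_(z in [set: n.-tuple M'])
   (outputs n (nth b0 z) `&` open_state (nth b0 z) n @^-1` Y)).
  apply: fin_bigcup_measurable => // z _; apply: measurableI.
    exact: measurable_outputs.
  apply: exogenous_measurable.
  by have := measurable_open_state (nth b0 z) n measurableT mY; rewrite setTI.
apply/seteqP; split => o /=.
  move=> Yo; exists [tuple q' i o | i < n] => //.
  have q'b : outputs n (nth b0 [tuple q' i o | i < n]) o.
    exact: ((eq_mktupleP b0 (fun i => q' i o) _).1 erefl).
  by split => //; rewrite /= -(open_stateE q'b (leqnn n)).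
by move=> [z _ [q'b]] /=; rewrite -(open_stateE q'b (leqnn n)).
Qed.

Definition joint_law n (z : n.-tuple M * n.-tuple M') : R :=
  Pr P (channel_use n (nth a0 z.1) (nth b0 z.2)).

Lemma pmf_joint_law n (E : pred (n.-tuple M * n.-tuple M')) :
  pmf_pr (@joint_law n) E = Pr P [set o | E (channel_record n o)].
Proof.
rewrite -[X in Pr P X]setIT Pr_partition//; last exact: measurable_channel_record.
by apply: eq_bigr => z _; rewrite setIT channel_recordE.
Qed.

(** The conditional law of the next input given the record of the past, with a point
mass for records of probability 0, so that a kernel results. *)
Definition input_law (a : seq M) (b : seq M') (c : M) : R :=
  let E := channel_use (size a) (nth a0 a) (nth b0 b) in
  if Pr P E == 0 then (c == a0)%:R
  else Pr P (E `&` [set o | q (size a) o = c]) / Pr P E.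

Lemma input_law_kernel : input_kernel input_law.
Proof.
move=> a b _; rewrite /input_law; set E := channel_use _ _ _.
have mE : measurable E by exact: measurable_channel_use.
have [_|E0] := eqVneq (Pr P E) 0; split.
- by move=> c; rewrite ler0n.
- by rewrite (bigD1 a0)//= eqxx big1 ?addr0// => c /negbTE ->.
- by move=> c; rewrite divr_ge0// Pr_ge0.
- rewrite -mulr_suml [X in X / _](_ : _ = Pr P E) ?divff//.
  rewrite [RHS](Pr_partitionT P (Z := q (size a)))//.
    by apply: eq_bigr => c _; rewrite setIC.
  by move=> c; exact: measurable_input.
Qed.

Lemma channel_use_eq n a b a' b' :
  (forall i, (i < n)%N -> a i = a' i /\ b i = b' i) ->
  channel_use n a b = channel_use n a' b'.
Proof.
move=> aa'; apply/seteqP; split => o h i ni; have [h1 h2] := h i ni;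
by have [e1 e2] := aa' i ni; rewrite h1 h2 e1 e2.
Qed.

(** Each step multiplies by the conditional law of the input and then, by the channel
step, by that of the output.  If the past has probability 0, so has the event to
which it is extended. *)
Lemma prod_input_law n a b :
  \prod_(t < n) (input_law (mkseq a t) (mkseq b t) (a t) *
     Q (mkseq a t.+1) (mkseq b t) (b t)) = Pr P (channel_use n a b).
Proof.
elim: n => [|n IH].
  rewrite big_ord0 (_ : channel_use _ _ _ = setT) ?PrT//.
  by apply/seteqP; split.
rewrite big_ord_recr /= IH /input_law size_mkseq.
rewrite (@channel_use_eq n (nth a0 (mkseq a n)) _ a b); last first.
  by move=> i ni; rewrite !nth_mkseq.
have := @Pr_channel_step n a b setT exogenousT; rewrite !setIT => ->.
have mU := measurable_channel_use n a b.
case: ifPn => [/eqP U0|U0]; last by field.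
have -> : Pr P (channel_use n a b `&` [set o | q n o = a n]) = 0.
  apply/eqP; rewrite eq_le Pr_ge0 andbT -U0; apply: Pr_le => //.
  by apply: measurableI => //; exact: measurable_input.
by rewrite U0 mul0r mulr0.
Qed.

Lemma feedback_law_joint n : @feedback_law R M M' Q input_law n = @joint_law n.
Proof.
apply/funext => z; rewrite /feedback_law /joint_law -prod_input_law.
apply: eq_bigr => t _.
by rewrite !(take_mkseq_nth a0) ?(take_mkseq_nth b0) ?(ltnW (ltn_ord t))//
  (tnth_nth a0) (tnth_nth b0).
Qed.

Section converse.
Variable n : nat.
Local Notation S := (n.+1.-tuple M * n.+1.-tuple M')%type.

Let Qf (t : 'I_n.+1) (s : S) : R :=
  Q (mkseq (nth a0 s.1) t.+1) (mkseq (nth b0 s.2) t) (nth b0 s.2 t).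

Let W (s : S) : R :=
  \prod_t Qf t s / pmf_pr (@joint_law n.+1) (fun s' => s'.2 == s.2).

(** The hypothesis of [directed_infoE] holds for the closed loop, by the channel step. *)
Lemma joint_law_prefix (t : 'I_n.+1) s :
  prefix_pr (@joint_law n.+1) t.+1 t.+1 s =
  Qf t s * prefix_pr (@joint_law n.+1) t.+1 t s.
Proof.
have tn := ltn_ord t; have tn' := ltnW tn.
rewrite /prefix_pr !pmf_joint_law.
have := @Pr_channel_step t (nth a0 s.1) (nth b0 s.2) setT exogenousT.
rewrite !setIT => h.
transitivity (Pr P (channel_use t.+1 (nth a0 s.1) (nth b0 s.2))).
  congr (Pr P _); apply/seteqP; split => o.
    move=> /(channel_record_prefixP o s tn tn)[h1 h2] i it.
    by split; [exact: h1|exact: h2].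
  move=> h1; apply/(channel_record_prefixP o s tn tn).
  by split => i it; case: (h1 i it).
rewrite h; congr (_ * Pr P _); apply/seteqP; split => o.
  move=> [h1 h2]; apply/(channel_record_prefixP o s tn tn'); split => i.
    rewrite ltnS leq_eqVlt => /orP[/eqP->//|it]; by case: (h1 i it).
  by move=> it; case: (h1 i it).
move=> /(channel_record_prefixP o s tn tn')[h1 h2]; split; last exact: h1.
by move=> i it; split; [apply: h1; exact: ltnW|exact: h2].
Qed.

Lemma joint_law_ge0 s : 0 <= @joint_law n.+1 s. Proof. exact: Pr_ge0. Qed.

Lemma sum_joint_law : \sum_s @joint_law n.+1 s = 1.
Proof.
have := @pmf_joint_law n.+1 xpredT; rewrite /pmf_pr => ->.
by rewrite -(PrT P); congr (Pr P _); apply/seteqP; split.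
Qed.

(** The ratio 1 / W changes the law of the loop into the one where the outputs are
drawn from their marginal r independently of (x_0, w).  There E is the event Eb b
once the outputs are b, and the open-loop inputs partition it. *)
Lemma sum_likelihood_le (E : set T) (Eb : (nat -> M') -> set T) del :
  0 <= del -> measurable E -> (forall b, exogenous (Eb b)) ->
  (forall b, outputs n.+1 b `&` E = outputs n.+1 b `&` Eb b) ->
  (forall b, Pr P (Eb b) <= del) ->
  \sum_(s : S) Pr P (channel_use n.+1 (nth a0 s.1) (nth b0 s.2) `&` E) / W s <= del.
Proof.
move=> del0 mE xEb EEb Ebdel.
pose r (zb : n.+1.-tuple M') := pmf_pr (@joint_law n.+1) (fun s' => s'.2 == zb).
have r0 zb : 0 <= r zb by apply: sumr_ge0 => s _; exact: joint_law_ge0.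
have r1 : \sum_zb r zb = 1.
  by rewrite -sum_joint_law /r /pmf_pr [RHS](partition_big snd xpredT).
apply: (@le_trans _ _ (\sum_(zb : n.+1.-tuple M') \sum_(za : n.+1.-tuple M)
  r zb * Pr P (open_inputs n.+1 (nth a0 za) (nth b0 zb) `&` Eb (nth b0 zb)))).
  rewrite exchange_big pair_big /=; apply: ler_sum => -[za zb] _ /=.
  set a := nth a0 za; set b := nth b0 zb.
  have -> : channel_use n.+1 a b `&` E = channel_use n.+1 a b `&` Eb b.
    by rewrite channel_useE -!setIA ![open_inputs _ _ _ `&` _]setIC !setIA EEb.
  pose PQ := \prod_t Qf t (za, zb).
  have -> : W (za, zb) = PQ / r zb by [].
  rewrite Pr_channel_use// -[\prod_(t < n.+1) _]/PQ invfM invrK.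
  have [->|PQ0] := eqVneq PQ 0.
    by rewrite !mul0r mulr_ge0// Pr_ge0.
  by rewrite mulrACA divff// mul1r mulrC.
apply: (@le_trans _ _ (\sum_zb r zb * del)); last by rewrite -mulr_suml r1 mul1r.
apply: ler_sum => zb _; rewrite -mulr_sumr; apply: ler_wpM2l => //.
apply: le_trans (Ebdel (nth b0 zb)); rewrite le_eqVlt; apply/orP; left; apply/eqP.
set b := nth b0 zb.
have E1 (za : n.+1.-tuple M) : [set o | [tuple open_input b i o | i < n.+1] = za] =
   open_inputs n.+1 (nth a0 za) b.
  apply/seteqP; split => o.
    exact: (eq_mktupleP a0 (fun i => open_input b i o) za).1.
  exact: (eq_mktupleP a0 (fun i => open_input b i o) za).2.
rewrite [RHS](Pr_partitionT P (Z := fun o => [tuple open_input b i o | i < n.+1])).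
- by apply: eq_bigr => za _; rewrite E1.
- move=> za; rewrite E1.
  by apply: exogenous_measurable; exact: exogenous_open_inputs.
- by apply: exogenous_measurable.
Qed.

(** Gibbs' inequality for the change of law of [sum_likelihood_le]; E and the sure event
are its two instances. *)
Lemma directed_info_ge (E : set T) (Eb : (nat -> M') -> set T) del :
  0 < del -> measurable E -> (forall b, exogenous (Eb b)) ->
  (forall b, outputs n.+1 b `&` E = outputs n.+1 b `&` Eb b) ->
  (forall b, Pr P (Eb b) <= del) ->
  (forall (a : seq M) (b : seq M'), size a = (size b).+1 ->
     forall y, 0 <= Q a b y) ->
  Pr P E * ln del^-1 - 1 <=
    ln 2 * directed_info (@feedback_law R M M' Q input_law n.+1).
Proof.
move=> del0 mE xEb EEb Ebdel Q0.
rewrite feedback_law_joint (directed_infoE (Qf := Qf)) //; first last.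
- exact: joint_law_prefix.
- exact: sum_joint_law.
- exact: joint_law_ge0.
have Qf0 (t : 'I_n.+1) s : 0 <= Qf t s by apply: Q0; rewrite !size_mkseq.
have W0 s : 0 <= W s.
  by rewrite divr_ge0 ?prodr_ge0// sumr_ge0// => s' _; exact: joint_law_ge0.
have ln2_gt0 : 0 < ln 2 :> R by rewrite ln_gt0// ltr1n.
have -> : ln 2 * (\sum_s @joint_law n.+1 s * log2 (\prod_t Qf t s /
    pmf_pr (@joint_law n.+1) (fun s' => s'.2 == s.2))) =
    \sum_s @joint_law n.+1 s * ln (W s).
  rewrite mulr_sumr; apply: eq_bigr => s _; rewrite mulrCA; congr (_ * _).
  by rewrite /log2 mulrC divfK// gt_eqF.
pose e (s : S) := Pr P (channel_use n.+1 (nth a0 s.1) (nth b0 s.2) `&` E).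
have -> : Pr P E = \sum_s e s.
  rewrite (Pr_partitionT P (Z := channel_record n.+1))//.
    by apply: eq_bigr => s _; rewrite channel_recordE.
  exact: measurable_channel_record.
apply: gibbs_event => //.
- move=> s; rewrite Pr_ge0 /=; apply: Pr_le => //.
  + by apply: measurableI => //; exact: measurable_channel_use.
  + exact: measurable_channel_use.
- move=> s ps; rewrite lt_neqAle W0 andbT eq_sym.
  have h := Pr_channel_use n.+1 (nth a0 s.1) (nth b0 s.2) exogenousT.
  rewrite setIT -/(joint_law s) in h.
  rewrite mulf_neq0// ?invr_eq0.
    by apply/eqP => W00; move: ps; rewrite h /Qf in W00 *; rewrite W00 mul0r ltxx.
  rewrite gt_eqF// /pmf_pr (bigD1 s)/= ?eqxx// ltr_pwDl// sumr_ge0// => s' _.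
  exact: joint_law_ge0.
- exact: sum_joint_law.
- exact: sum_likelihood_le (ltW del0) mE xEb EEb Ebdel.
- have := @sum_likelihood_le setT (fun=> setT) 1 ler01 measurableT
    (fun=> exogenousT).
  move=> /(_ (fun=> erefl) _); rewrite PrT => /(_ (fun=> lexx _)).
  by under eq_bigr do rewrite setIT.
Qed.

End converse.

End closed_loop.

(** * The capacity bound *)

Lemma exists_prob_gt d (T : measurableType d) (R : realType)
    (P : probability T R) (F : (set T)^nat) (eps : R) :
  (forall n, measurable (F n)) -> nondecreasing_seq F ->
  \bigcup_n F n = setT -> 0 < eps -> exists n, 1 - eps < Pr P (F n).
Proof.
move=> mF ndF FT eps0.
have cF : P (F n) @[n --> \oo] --> 1%:E.
  by rewrite -(@probability_setT _ _ _ P) -FT;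
    exact: (nondecreasing_cvg_mu mF (bigcupT_measurable _ mF) ndF).
have cF' : Pr P (F n) @[n --> \oo] --> (1 : R) by exact: fine_cvg cF.
have /cvgrPdist_lt/(_ eps eps0) := cF'.
move=> [n _ /(_ n (leqnn n))] /=; rewrite ltr_norml => /andP[_ h].
by exists n; lra.
Qed.

Lemma exists_natmul_gt (R : realType) (a b : R) : 0 < b ->
  exists n0, forall n, (n0 <= n)%N -> a < n%:R * b.
Proof.
move=> b0; exists (Num.bound (`|a| / b)) => n n0n.
have := archi_boundP (divr_ge0 (normr_ge0 a) (ltW b0)).
rewrite ltr_pdivrMr// => h; apply: le_lt_trans (ler_norm a) _.
by apply: (lt_le_trans h); rewrite ler_pM2r// ler_nat.
Qed.

Lemma rate_le_limit (R : realType) (m : R^nat) (C th A : R) :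
  (fun n => (n.+1%:R)^-1 * m n) @ \oo --> C ->
  (forall n0, exists2 n, (n0 <= n)%N & n.+1%:R * th - A <= m n) -> th <= C.
Proof.
move=> mC inf; apply/ler_addgt0Pr => e e0.
have e20 : 0 < e / 2 by rewrite divr_gt0.
have /cvgrPdist_lt/(_ _ e20)[n1 _ mC1] := mC.
have [n2 n2A] := exists_natmul_gt A e20.
have [n] := inf (maxn n1 n2); rewrite geq_max => /andP[n1n n2n] mn.
have := mC1 n n1n; rewrite /= ltr_norml => /andP[h _].
have n0 : 0 < n.+1%:R :> R by [].
have h2 : m n < n.+1%:R * (C + e / 2).
  rewrite mulrC -ltr_pdivrMr// [m n / _]mulrC.
  by move: h; set y := _ * m n; lra.
have h3 : A < n.+1%:R * (e / 2) by apply: n2A; exact: leqW.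
have : n.+1%:R * th < n.+1%:R * (C + e) .
  have -> : n.+1%:R * (C + e) = n.+1%:R * (C + e / 2) + n.+1%:R * (e / 2).
    by field.
  lra.
by rewrite ltr_pM2l// => /ltW.
Qed.

(** If b stayed below l - eps from n0 on, its averages would be at most
l - eps + n0 (1 + |l - eps|) / n. *)
Lemma cesaro_infinitely_often (R : realType) (b : R^nat) (l eps : R) :
  (forall n, b n <= 1) ->
  (fun n => n%:R^-1 * \sum_(0 <= k < n) b k) @ \oo --> l -> 0 < eps ->
  forall n0, exists2 n, (n0 <= n)%N & l - eps <= b n.
Proof.
move=> b1 bl eps0 n0; apply: contrapT => nex.
have lt n : (n0 <= n)%N -> b n < l - eps.
  move=> n0n; rewrite ltNge; apply/negP => h; apply: nex; by exists n.
have e20 : 0 < eps / 2 by rewrite divr_gt0.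
have /cvgrPdist_lt/(_ _ e20)[n1 _ bl1] := bl.
have [n2 n2A] := exists_natmul_gt (n0%:R * (1 + `|l - eps|)) e20.
pose n := maxn (maxn n1 n2) (maxn n0 1).
have [n1n n2n n0n n_gt0] : [/\ (n1 <= n)%N, (n2 <= n)%N, (n0 <= n)%N & (0 < n)%N].
  by split; rewrite /n !leq_max leqnn ?orbT.
have np : 0 < n%:R :> R by rewrite ltr0n.
have := bl1 n n1n; rewrite /= ltr_norml => /andP[_ h].
have : n%:R * (l - eps / 2) < \sum_(0 <= k < n) b k.
  rewrite mulrC -ltr_pdivlMr// [X in _ < X]mulrC.
  by move: h; set y := _ * \sum_(_ <= _ < _) _; lra.
rewrite (big_cat_nat _ n0n)//=.
have : \sum_(0 <= k < n0) b k <= n0%:R.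
  apply: (@le_trans _ _ (\sum_(0 <= k < n0) 1)); first by apply: ler_sum.
  by rewrite sumr_const_nat subn0.
have : \sum_(n0 <= k < n) b k <= (n - n0)%:R * (l - eps).
  apply: (@le_trans _ _ (\sum_(n0 <= k < n) (l - eps))).
    by apply: ler_sum_nat => k /andP[n0k _]; exact/ltW/lt.
  by rewrite sumr_const_nat mulr_natl.
rewrite natrB// mulrBl.
have := n2A n n2n.
have : - (n0%:R * (l - eps)) <= n0%:R * `|l - eps|.
  by rewrite -mulrN ler_wpM2l// -normrN ler_norm.
set N0 := n0%:R; set Nn := n%:R; set y := `|_|.
set S1 := \sum_(0 <= _ < n0) _; set S2 := \sum_(n0 <= _ < n) _; nra.
Qed.

Lemma iter_shift (R : realType) N i (s : nat -> 'rV[R]_N) n :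
  iter i Defs.shift s n = s (i + n)%N.
Proof. by elim: i n => [//|i IH] n /=; rewrite /Defs.shift IH addnS. Qed.

Lemma det_jacobian_ge (R : realType) N (f : 'rV[R]_N -> 'rV[R]_N) (l : R) v :
  ereal_inf (range (log2_jacobian f)) = l%:E ->
  expR (l * ln 2) <= `|\det ('J f v)|.
Proof.
move=> fl; have : (l%:E <= log2_jacobian f v)%E.
  by rewrite -fl; apply: ereal_inf_lbound; exists v.
have ln2_gt0 : 0 < ln 2 :> R by rewrite ln_gt0// ltr1n.
rewrite /log2_jacobian /elog2; set D := `|_|.
have [D0|D0] := ltP 0 D; last first.
  rewrite le0_lneNy ?lee_fin// gt0_mulNye ?lte_fin ?invr_gt0//.
rewrite lne_EFin// -EFinM lee_fin ler_pdivlMr// => h.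
by rewrite -[D]lnK ?posrE// ler_expR.
Qed.

Lemma inhabited_of_probability d (T : measurableType d) (R : realType)
  (P : probability T R) : exists o : T, True.
Proof.
apply: contrapT => nT; have := probability_setT P.
rewrite (_ : setT = set0); last first.
  by apply/seteqP; split => // o _; apply: nT; exists o.
by rewrite measure0 => /eqP; rewrite eqe eq_sym oner_eq0.
Qed.

Theorem theorem3p2 (R : realType) (d : measure_display) (T : measurableType d)
    (P : probability T R) (N k : nat) (M M' : finType)
    (f : 'rV[R]_N -> 'rV[R]_N) (B : 'M[R]_(N, k))
    (nu : probability 'rV[R]_N R)
    (Q : seq M -> seq M' -> M' -> R) (C : R)
    (x w : nat -> T -> 'rV[R]_N) (u : nat -> T -> 'rV[R]_k)
    (q : nat -> T -> M) (q' : nat -> T -> M') (p : 'rV[R]_N -> R)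
    (f_meas : measurable_fun [set: 'rV[R]_N] f)
    (f_diff : forall v, differentiable f v)
    (f_C1 : continuous (fun v => 'J f v))
    (f_inv : bijective f)
    (x0_meas : measurable_fun [set: T] (x 0%N))
    (w_iid : iid P w nu)
    (w_x0 : independent_of_sequence P (x 0%N) w)
    (q'_meas : forall t, finite_rv (q' t))
    (sys : controlled_system f B x u w)
    (policy : causal_policy x q q' u)
    (Q_kernel : channel_kernel Q)
    (Q_output : channel_output P Q q q')
    (Q_classA : class_A P Q C (x 0%N) w q q')
    (x0_density : has_density P (x 0%N) p)
    (x0_entropy : (differential_entropy p < +oo)%E)
    (M_fin : (ereal_sup (range (log2_jacobian f)) < +oo)%E)
    (L_fin : (-oo < ereal_inf (range (log2_jacobian f)))%E)
    (x_AMS : AMS (process_measure P x)) :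
  (ereal_inf (range (log2_jacobian f)) <= C%:E)%E.
Proof.
have [w_meas _ _] := w_iid.
have [[ge [mge qE]] [g uE]] := policy.
have [cond [m [m_max mC]]] := Q_classA.
have [t0 _] := (inhabited_of_probability P).
pose a0 := q 0%N t0; pose b0 := q' 0%N t0.
have Qcond t A := cond t A _ (Q_output t A).
have Q0 a b : size a = (size b).+1 -> forall y, 0 <= Q a b y.
  by move=> ab; have [] := Q_kernel a b ab.
have ln2_gt0 : 0 < ln 2 :> R by rewrite ln_gt0// ltr1n.
have [l lE] : exists l, ereal_inf (range (log2_jacobian f)) = l%:E.
  have : (ereal_inf (range (log2_jacobian f)) < +oo)%E.
    apply: le_lt_trans M_fin; apply: (@le_trans _ _ (log2_jacobian f 0)).
      by apply: ereal_inf_lbound; exists 0.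
    by apply: ereal_sup_ubound; exists 0.
  by case: ereal_inf L_fin => // l _ _; exists l.
rewrite lE lee_fin.
pose c := expR (l * ln 2); have c0 : 0 < c by exact: expR_gt0.
have fle := lebesgue_preimage_le f_meas f_diff f_C1 (bij_inj f_inv) c0
  (fun v => det_jacobian_ge v lE).
have [mp p0 _] := x0_density.
have mpk (r : R) : measurable [set o | p (x 0%N o) <= r].
  have mpx := measurableT_comp mp x0_meas.
  have := mpx measurableT _ (@measurable_itv R `]-oo, r]).
  by rewrite setTI; congr measurable; apply/seteqP; split => o; rewrite /= in_itv.
have mx n : measurable_fun [set: T] (x n).
  exact: (measurable_state b0 f_meas x0_meas w_meas q'_meas sys uE).
have bound n (K : set 'rV[R]_N) kap del : measurable K -> 0 <= kap -> 0 < del ->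
    (kap%:E * ((c ^- n.+1)%:E * lebesgue_rV N K) <= del%:E)%E ->
    let E := [set o | K (x n.+1 o) /\ p (x 0%N o) <= kap] in
    measurable E /\ Pr P E * ln del^-1 - 1 <= ln 2 * m n.
  move=> mK kap0 del0 Kdel E.
  pose Eb b := [set o | K (open_state f B x w g b n.+1 o) /\ p (x 0%N o) <= kap].
  have EEb b : outputs q' n.+1 b `&` E = outputs q' n.+1 b `&` Eb b.
    apply/seteqP; split => o [q'b Eo]; split => //; move: Eo;
    by rewrite /E /Eb /= (open_stateE sys uE q'b (leqnn _)).
  have xEb b : exogenous x w (Eb b).
    apply: exogenousI.
      have := measurable_open_state (x := x) (w := w) B g f_meas b n.+1
        measurableT mK.
      by rewrite setTI.
    apply: sub_sigma_algebra; left.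
    exists [set v | p v <= kap]; last by rewrite setTI.
    rewrite -[X in measurable X]setTI.
    have := mp measurableT _ (@measurable_itv R `]-oo, kap]).
    by congr measurable; apply/seteqP; split => v; rewrite /= in_itv.
  have mEb b : measurable (Eb b) by exact: (exogenous_measurable x0_meas w_meas).
  have mE : measurable E.
    apply: measurableI; last exact: mpk.
    by rewrite -[X in measurable X]setTI; exact: mx.
  split => //.
  have Ebdel b : Pr P (Eb b) <= del.
    rewrite -lee_fin PrK//.
    exact: (prob_trajectory_le x0_meas w_meas w_x0 x0_density _ c0 kap0 f_meas
      fle mK Kdel).
  apply: le_trans (directed_info_ge (n := n) a0 b0 f_meas x0_meas w_meas q'_meas sys
    mge qE uE Qcond del0 mE xEb EEb Ebdel Q0) _.
  rewrite ler_pM2l//; apply: (m_max n).2.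
  exact: (input_law_kernel P a0 b0 f_meas x0_meas w_meas q'_meas sys mge qE uE).
(* the impossible event gives the nonnegativity of the capacity *)
have C0 : 0 <= C.
  apply: (rate_le_limit (A := (ln 2)^-1) mC) => n0; exists n0 => //.
  have := @bound n0 set0 0 1 measurable0 (lexx _) ltr01.
  rewrite mul0e lee_fin => /(_ ler01)[_].
  rewrite invr1 ln1 mulr0 mulr0 !sub0r => h.
  by rewrite lerNl -[leRHS]mul1r ler_pdivlMr//; lra.
have [Pbar PbarE] := x_AMS.
rewrite leNgt; apply/negP => Cl.
have l0 : 0 < l by exact: le_lt_trans Cl.
(* 3 eps is the total loss in the probability of E, from the choice of K, from the
visits to K and from the truncation of the density; this eps makes
(1 - 3 eps) l the midpoint of C and l. *)
pose eps := (l - C) / (6 * l).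
have eps0 : 0 < eps by rewrite divr_gt0 ?subr_gt0// mulr_gt0.
pose K r : set 'rV[R]_N := box (fun=> `[- r%:R, r%:R]%classic).
have mK r : measurable (K r) by apply: measurable_box => i; exact: measurable_itv.
pose FK r : set (nat -> 'rV[R]_N) := [set s | K r (s 0%N)].
have mFK r : <<s cylinder_gen >> (FK r).
  apply: sub_sigma_algebra; exists 0%N => //; exists (K r); first exact: mK.
  by rewrite setTI.
have [r Pr_r] : exists r, 1 - eps < Pr Pbar (FK r).
  apply: exists_prob_gt => //.
    move=> i j ij; apply/subsetPset => s Ks e; have := Ks e.
    rewrite /= !in_itv /= => /andP[h1 h2]; apply/andP; split.
      by apply: le_trans h1; rewrite lerN2 ler_nat.
    by apply: (le_trans h2); rewrite ler_nat.
  apply/seteqP; split => // s _; exists (Num.bound `|s 0%N|) => // i.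
  rewrite /= in_itv /= -ler_norml; apply: le_trans (norm_coord_le _ _ _) _.
  by apply: ltW; exact: archi_boundP.
have [kap Pr_kap] : exists kap : nat,
    1 - eps < Pr P [set o | p (x 0%N o) <= kap%:R].
  apply: (@exists_prob_gt _ _ _ P
    (fun j : nat => [set o | p (x 0%N o) <= j%:R]) eps _ _ _ eps0).
  - by move=> j; exact: mpk.
  - move=> i j ij; apply/subsetPset => o /= h; apply: (le_trans h).
    by rewrite ler_nat.
  - apply/seteqP; split => // o _; exists (Num.bound (p (x 0%N o))) => //=.
  by apply: ltW; exact: archi_boundP (p0 _).
have mKx n : measurable [set o | K r (x n o)].
  by rewrite -[X in measurable X]setTI; exact: (mx n measurableT _ (mK r)).
have often n0 : exists2 n, (n0 <= n)%N & 1 - 2 * eps <= Pr P [set o | K r (x n o)].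
  have Pn1 n : Pr P [set o | K r (x n o)] <= 1 by rewrite -(PrT P); exact: Pr_le.
  have cK : (fun n => n%:R^-1 * \sum_(0 <= i < n) Pr P [set o | K r (x i o)])
      @ \oo --> Pr Pbar (FK r).
    have cF := PbarE _ (mFK r); rewrite -(PrK Pbar (mFK r)) in cF.
    set a := (a in a @ _ --> _).
    suff -> : a = (fun n : nat => fine ((n%:R^-1)%:E *
        \sum_(0 <= i < n) process_measure P x (iter i Defs.shift @^-1` FK r))%E).
      exact: (fine_cvg cF).
    apply/funext => n; rewrite /a.
    rewrite (eq_bigr (fun i => (Pr P [set o | K r (x i o)])%:E)) => [|i _].
      by rewrite sumEFin -EFinM.
    rewrite PrK// /process_measure; congr (P _); apply/seteqP; split => o;
    by rewrite /= /FK /= iter_shift addn0.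
  have [n n0n Kn] := cesaro_infinitely_often Pn1 cK eps0 n0.
  by exists n => //; lra.
(* D c ^- n bounds the probability of hitting K under independent outputs; the
additional 1 keeps its logarithm meaningful when K is negligible. *)
pose D := kap%:R * fine (lebesgue_rV N (K r)) + 1.
have D0 : 0 < D by rewrite ltr_wpDl// mulr_ge0// fine_ge0.
have KD : (kap%:R%:E * lebesgue_rV N (K r) <= D%:E)%E.
  rewrite -[lebesgue_rV N (K r)]fineK ?ge0_fin_numE ?lebesgue_box_fin//.
  by rewrite -EFinM lee_fin /D lerDl.
suff : (1 - 3 * eps) * l <= C.
  have -> : (1 - 3 * eps) * l = l - (l - C) / 2.
    by rewrite /eps; field; rewrite gt_eqF.
  by move: Cl; lra.
apply: (rate_le_limit (A := ((1 - 3 * eps) * ln D + 1) / ln 2) mC) => n0.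
have [n1 n1D] := exists_natmul_gt (ln D) (mulr_gt0 l0 ln2_gt0).
have [n] := often (maxn n0 n1).+1; case: n => [//|n].
rewrite ltnS geq_max => /andP[n0n n1n] Kn; exists n => //.
pose del := D * c ^- n.+1.
have del0 : 0 < del by rewrite divr_gt0// exprn_gt0.
have [||mE h] := @bound n (K r) kap%:R del (mK r) _ del0; first by [].
  rewrite muleCA /del mulrC EFinM; apply: lee_wpmul2l => //.
  by rewrite lee_fin invr_ge0 exprn_ge0// ltW.
have lnE : ln del^-1 = n.+1%:R * (l * ln 2) - ln D.
  rewrite /del invfM invrK lnM ?posrE ?invr_gt0 ?exprn_gt0// lnV ?posrE//.
  by rewrite lnXn ?expR_gt0// /c expRK -[_ *+ n.+1]mulr_natl addrC.
have ln0 : 0 <= ln del^-1.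
  by rewrite lnE subr_ge0; apply: ltW; apply: n1D; exact: leqW.
have PE : 1 - 3 * eps <= Pr P [set o | K r (x n.+1 o) /\ p (x 0%N o) <= kap%:R].
  by have := Pr_setI_ge P (mKx n.+1) (mpk kap%:R); lra.
rewrite -(ler_pM2l ln2_gt0); apply: le_trans h.
have := ler_wpM2r ln0 PE; rewrite [in leLHS]lnE => {}h.
have -> : ln 2 * (n.+1%:R * ((1 - 3 * eps) * l) -
    ((1 - 3 * eps) * ln D + 1) / ln 2) =
  (1 - 3 * eps) * (n.+1%:R * (l * ln 2) - ln D) - 1.
  by field; rewrite gt_eqF.
lra.
Qed.
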